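(* Let $E$ be a complex Banach lattice and let $(e^{tA})_{t \in [0,\infty)}$ be a uniformly eventually positive $C_0$-semigroup on $E$ which is bounded and norm continuous at infinity. Then the following are equivalent: (i) The limit $\lim_{t \to \infty} e^{tA}f$ exists for every $f \in E$. (ii) The semigroup is mean ergodic.
   Context: A $C_0$-semigroup $(e^{tA})_{t\ge 0}$ on a complex Banach lattice $E$ is uniformly eventually positive if there exists $t_0 \ge 0$ such that $e^{tA}$ is a positive operator (i.e. $e^{tA}f \ge 0$ for all $0\le f\in E$) for every $t \ge t_0$. Let $\omega_0(A)$ denote the growth bound of the semigroup. The semigroup is called norm continuous at infinity if $\omega_0(A) > -\infty$ and the rescaled semigroup $S(t) := e^{t(A-\omega_0(A)I)}$ satisfies $\limsup_{s \to 0} \|S(t) - S(t+s)\| \to 0$ as $t \to \infty$ (the phrase ''norm continuous at infinity'' always tacitly includes $\omega_0(A) > -\infty$). The semigroup is called mean ergodic if for every $f \in E$ the Cesàro means $\frac{1}{t}\int_0^t e^{sA}f\,ds$ converge in norm as $t \to \infty$. *)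

(* Defs.v *)
From HB Require Import structures.
From mathcomp Require Import all_boot all_order all_algebra.
From mathcomp Require Import all_classical all_reals all_analysis.
Set Implicit Arguments. Unset Strict Implicit. Unset Printing Implicit Defensive.
Import Order.TTheory GRing.Theory Num.Theory.
Import numFieldNormedType.Exports.
Local Open Scope classical_set_scope.
Local Open Scope ring_scope.

Definition is_lubP (V : Type) (le : V -> V -> Prop) (A : set V) (s : V) : Prop :=
  (forall a, A a -> le a s) /\ (forall u, (forall a, A a -> le a u) -> le s u).

Record BanachLattice (R : realType) (V : completeNormedModType R) := {
  bl_le : V -> V -> Prop;
  bl_refl : forall x, bl_le x x;
  bl_anti : forall x y, bl_le x y -> bl_le y x -> x = y;
  bl_trans : forall x y z, bl_le x y -> bl_le y z -> bl_le x z;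
  bl_add : forall x y z, bl_le x y -> bl_le (x + z) (y + z);
  bl_scale : forall (r : R) x, 0 <= r -> bl_le 0 x -> bl_le 0 (r *: x);
  bl_sup : forall x y, exists s, is_lubP bl_le [set v | v = x \/ v = y] s;
  bl_norm : forall x y ax ay,
      is_lubP bl_le [set v | v = x \/ v = - x] ax ->
      is_lubP bl_le [set v | v = y \/ v = - y] ay ->
      bl_le ax ay -> `|x| <= `|y|
}.

Section Complexification.
Variables (R : realType) (V : completeNormedModType R) (BL : BanachLattice V).

(* The complex Banach lattice E = V + iV, elements z = (Re z, Im z). *)
Definition cadd (z w : V * V) : V * V := (z.1 + w.1, z.2 + w.2).
Definition csub (z w : V * V) : V * V := (z.1 - w.1, z.2 - w.2).
Definition cscale (a b : R) (z : V * V) : V * V :=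
  (a *: z.1 - b *: z.2, a *: z.2 + b *: z.1).
Definition rscale (r : R) (z : V * V) : V * V := (r *: z.1, r *: z.2).

(* modulus |x + i y| = sup_theta (cos theta x + sin theta y) (exists in any
   real Banach lattice); norm of z is the norm of its modulus *)
Definition cmod_set (z : V * V) : set V :=
  [set v | exists th : R, v = cos th *: z.1 + sin th *: z.2].
Definition cmod (z : V * V) : V :=
  xget 0 [set m | is_lubP (bl_le BL) (cmod_set z) m].
Definition cnorm (z : V * V) : R := `|cmod z|.

Definition clinear (S : V * V -> V * V) : Prop :=
  (forall z w, S (cadd z w) = cadd (S z) (S w)) /\
  (forall a b z, S (cscale a b z) = cscale a b (S z)).
Definition cbounded (S : V * V -> V * V) : Prop :=
  exists M : R, forall z, cnorm (S z) <= M * cnorm z.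
Definition cpositive (S : V * V -> V * V) : Prop :=
  forall x, bl_le BL 0 x -> (S (x, 0)).2 = 0 /\ bl_le BL 0 (S (x, 0)).1.

(* T t = e^{tA}, only its values for t >= 0 matter *)
Definition C0_semigroup (T : R -> V * V -> V * V) : Prop :=
  (forall t, 0 <= t -> clinear (T t) /\ cbounded (T t)) /\
  (forall z, T 0 z = z) /\
  (forall t s, 0 <= t -> 0 <= s -> forall z, T (t + s) z = T t (T s z)) /\
  (forall z e, 0 < e -> exists d, 0 < d /\
     forall t, 0 <= t -> t < d -> cnorm (csub (T t z) z) <= e).

Definition unif_eventually_positive (T : R -> V * V -> V * V) : Prop :=
  exists t0, 0 <= t0 /\ forall t, t0 <= t -> cpositive (T t).

Definition sg_bounded (T : R -> V * V -> V * V) : Prop :=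
  exists M : R, forall t z, 0 <= t -> cnorm (T t z) <= M * cnorm z.

Definition growth_bound (T : R -> V * V -> V * V) : \bar R :=
  ereal_inf [set w%:E | w in [set w : R | exists M : R, forall t z,
     0 <= t -> cnorm (T t z) <= M * expR (w * t) * cnorm z]].

(* omega_0 > -oo and, with S(t) = e^{-omega_0 t} T t,
   limsup_{s -> 0} ||S(t) - S(t+s)|| -> 0 as t -> oo *)
Definition norm_continuous_at_infinity (T : R -> V * V -> V * V) : Prop :=
  (growth_bound T != -oo)%E /\
  let w := fine (growth_bound T) in
  forall e, 0 < e -> exists T0 : R, forall t, T0 <= t ->
    exists d, 0 < d /\ forall s, `|s| < d -> 0 <= t + s -> forall z,
      cnorm (csub (rscale (expR (- w * t)) (T t z))
                  (rscale (expR (- w * (t + s))) (T (t + s) z))) <= e * cnorm z.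

Definition cconverges_to (g : R -> V * V) (L : V * V) : Prop :=
  forall e, 0 < e -> exists T0 : R, forall t, T0 <= t -> cnorm (csub (g t) L) <= e.

Definition rsum (g : R -> V * V) (t : R) (n : nat) : V * V :=
  rscale (t / n%:R)
    (\sum_(k < n) (g (k%:R * t / n%:R)).1, \sum_(k < n) (g (k%:R * t / n%:R)).2).

(* I = \int_0^t g(s) ds (Riemann integral, g continuous) *)
Definition is_cint (g : R -> V * V) (t : R) (I : V * V) : Prop :=
  forall e, 0 < e -> exists N, forall n, (N <= n)%N -> cnorm (csub (rsum g t n) I) <= e.

Definition mean_ergodic (T : R -> V * V -> V * V) : Prop :=
  forall z, exists L, forall e, 0 < e -> exists T0 : R, 0 < T0 /\
    forall t, T0 <= t -> forall I, is_cint (fun s => T s z) t I ->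
      cnorm (csub (rscale t^-1 I) L) <= e.

End Complexification.

(* Main.v *)
Require Import Defs.
From HB Require Import structures.
From mathcomp Require Import all_boot all_order all_algebra.
From mathcomp Require Import all_classical all_reals all_analysis.
From mathcomp Require Import ring lra.
Set Implicit Arguments.
Unset Strict Implicit.
Unset Printing Implicit Defensive.
Import Order.TTheory GRing.Theory Num.Theory.
Import numFieldNormedType.Exports.
Local Open Scope ring_scope.

(** Let [S] be the real part of the semigroup at large times. A positive
    complete orbit of the adjoint is a family [y : R -> V'_+] with
    [y (t + s) = S(s)' (y t)] for all real [t] and large [s], bounded in [t].
    Such orbits form a lattice: the infimum of [y] and [z] at time [t] is the
    decreasing limit of [S(s)' (y (t - s) /\ z (t - s))], which exists because
    bounded monotone nets of functionals converge pointwise. Time shifts act on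
    this lattice as a bounded group of lattice automorphisms, and norm continuity
    at infinity makes this group norm continuous. A small shift [U] preserves
    disjointness: if [h] lies below [U a] and [b] with [a], [b] disjoint, then
    [h] and [U^-1 h] are disjoint, which is impossible for [U] close to the
    identity unless [h = 0]. It follows that all these orbits are constant.

    If [limsup |(S(t + a) u - S(t + b) u)^+|] were positive for some [u >= 0],
    Hahn-Banach applied to the sublinear functional [limsup |(g t)^+|] on
    bounded functions [g] would produce a nonconstant positive complete orbit.
    Hence [T(t + s) z - T(t) z] tends to [0], and comparing [z] with its Cesaro
    means turns mean ergodicity into convergence. When the growth bound is
    negative everything converges to [0]. *)

(** * Hahn-Banach via minimal sublinear functionals *)

Lemma le_inf_add (R : realType) (A B : set R) (c : R) :
  A !=set0%classic -> B !=set0%classic ->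
  (forall a b, A a -> B b -> c <= a + b) -> c <= inf A + inf B.
Proof.
move=> A0 B0 h.
have : c - inf A <= inf B.
  apply: lb_le_inf => // b Bb.
  suff : c - b <= inf A by lra.
  by apply: lb_le_inf => // a Aa; have := h _ _ Aa Bb; lra.
by lra.
Qed.

Lemma inf_le_of (R : realType) (A : set R) (m a : R) :
  (forall x, A x -> m <= x) -> A a -> inf A <= a.
Proof. by move=> h; apply: ge_inf; exists m => x /h. Qed.

Section HahnBanach.
Variables (R : realType) (X : lmodType R) (D : set X).
Hypothesis D_add : forall x y, D x -> D y -> D (x + y).
Hypothesis D_scale : forall (t : R) x, D x -> D (t *: x).

Definition sublinear (q : X -> R) :=
  (forall x y, D x -> D y -> q (x + y) <= q x + q y) /\
  (forall t x, 0 <= t -> D x -> q (t *: x) = t * q x).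

Lemma D_opp x : D x -> D (- x).
Proof. by rewrite -scaleN1r; exact: D_scale. Qed.

Lemma sublinear0 q x : D x -> sublinear q -> q 0 = 0.
Proof. by move=> Dx [_ h]; rewrite -(scale0r x) h// mul0r. Qed.

Lemma sublinear_lower q x : sublinear q -> D x -> - q (- x) <= q x.
Proof.
move=> sq Dx; have := sq.1 _ _ Dx (D_opp Dx).
by rewrite subrr (sublinear0 Dx sq); lra.
Qed.

(** For sublinear [q], the largest sublinear functional below [q] whose value at [- y] is at most
    [- q y]. An additive functional below it is at least [q y] at [y]. *)
Definition tilt (q : X -> R) (y x : X) : R :=
  inf [set r | exists2 t : R, 0 <= t & r = q (x + t *: y) - t * q y]%classic.

Section Tilt.
Variables (q : X -> R) (y : X).
Hypotheses (sq : sublinear q) (Dy : D y).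

Lemma tilt_le x t : D x -> 0 <= t -> tilt q y x <= q (x + t *: y) - t * q y.
Proof.
move=> Dx t0; apply: (@inf_le_of _ _ (- q (- x))); last by exists t.
move=> _ [s s0 ->]; rewrite -(sq.2 _ _ s0 Dy).
have := sq.1 _ _ (D_add Dx (D_scale s Dy)) (D_opp Dx).
by rewrite addrAC subrr add0r; lra.
Qed.

Lemma tilt_le_self x : D x -> tilt q y x <= q x.
Proof. by move=> Dx; have := tilt_le Dx (lexx 0); rewrite scale0r addr0 mul0r subr0. Qed.

Lemma tilt_ge x c :
  (forall t, 0 <= t -> c <= q (x + t *: y) - t * q y) -> c <= tilt q y x.
Proof.
move=> h; apply: lb_le_inf; first by exists (q (x + 0 *: y) - 0 * q y); exists 0.
by move=> _ [t t0 ->]; exact: h.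
Qed.

Lemma tilt_sublinear : sublinear (tilt q y).
Proof.
(* One inequality for all positive [t] is enough: the reverse one is this applied to [t^-1] and
   [t *: x]. *)
have tz t x : 0 < t -> D x -> tilt q y (t *: x) <= t * tilt q y x.
  move=> t0 Dx; rewrite -ler_pdivrMl//; apply: tilt_ge => s s0.
  rewrite ler_pdivrMl// mulrBr mulrA.
  rewrite -(sq.2 _ _ (ltW t0)) ?scalerDr ?scalerA; last exact/D_add/D_scale.
  by apply: tilt_le; [exact: D_scale|exact/mulr_ge0/s0/ltW].
split=> [x x' Dx Dx'|t x].
  apply: le_inf_add.
  - by exists (q (x + 0 *: y) - 0 * q y); exists 0.
  - by exists (q (x' + 0 *: y) - 0 * q y); exists 0.
  - move=> _ _ [s s0 ->] [t t0 ->].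
    have := tilt_le (D_add Dx Dx') (addr_ge0 s0 t0).
    have := sq.1 _ _ (D_add Dx (D_scale s Dy)) (D_add Dx' (D_scale t Dy)).
    by rewrite addrACA -scalerDl; lra.
rewrite le_eqVlt => /predU1P[<- Dx|t0 Dx].
  rewrite scale0r mul0r; apply/eqP; rewrite eq_le; apply/andP; split.
    have D0 : D 0 by rewrite -(scale0r x); exact: D_scale.
    by have := tilt_le_self D0; rewrite (sublinear0 Dx sq).
  by apply: tilt_ge => s s0; rewrite add0r sq.2// subrr.
apply/eqP; rewrite eq_le tz//= -ler_pdivlMl//.
have := tz t^-1 (t *: x); rewrite invr_gt0 scalerA mulVf ?gt_eqF// scale1r.
by apply => //; exact: D_scale.
Qed.

End Tilt.

(* A minimal sublinear functional [q] satisfies [q <= tilt q y <= q], which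
   forces additivity; tilting [p] at [w] beforehand makes the value at [w]
   maximal. *)
Lemma hahn_banach (p : X -> R) (w : X) : sublinear p -> D w ->
  exists f : X -> R, [/\ forall x y, D x -> D y -> f (x + y) = f x + f y,
    forall x, D x -> f x <= p x & p w <= f w].
Proof.
move=> sp Dw; pose p' := tilt p w.
have sp' : sublinear p' by exact: tilt_sublinear.
pose P q := sublinear q /\ forall x, D x -> q x <= p' x.
pose T := {q : X -> R | P q}.
(* The order is reversed, so that Zorn's lemma yields a pointwise minimal functional. *)
pose r (q q' : T) := `[< forall x, D x -> sval q' x <= sval q x >].
have t0 : T by exists p'.
have [||A Atot|q qmax] := @ZL_preorder T t0 r.
- by move=> q; apply/asboolP.
- by move=> b a c /asboolP ab /asboolP bc; apply/asboolP => x Dx; exact/(le_trans (bc x Dx))/ab.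
- have [[a0 Aa0]|A0] := pselect (A !=set0%classic); last first.
    by exists t0 => s As; case: A0; exists s.
  (* The chain is bounded below by its pointwise infimum, finite because every member is at least
     [- p' (- x)] at [x]. It is subadditive because the smaller of two members serves for both
     arguments. *)
  pose E x := [set u | exists2 a, A a & u = sval a x]%classic.
  have E0 x : E x !=set0%classic by exists (sval a0 x); exists a0.
  have Elb x a : D x -> A a -> inf (E x) <= sval a x.
    move=> Dx Aa; apply: (@inf_le_of _ _ (- p' (- x))); last by exists a.
    move=> _ [[b [sb bp]] Ab ->] /=.
    by have := sublinear_lower sb Dx; have := bp _ (D_opp Dx); lra.
  have Ez t x : 0 < t -> D x -> inf (E (t *: x)) <= t * inf (E x).
    move=> tp Dx; rewrite -ler_pdivrMl//; apply: lb_le_inf => // _ [a Aa ->].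
    rewrite ler_pdivrMl// -((svalP a).1.2 _ _ (ltW tp) Dx).
    by apply: Elb => //; exact: D_scale.
  have sE : sublinear (fun x => inf (E x)) /\ forall x, D x -> inf (E x) <= p' x.
    split; last by move=> x Dx; exact/(le_trans (Elb _ _ Dx Aa0))/(svalP a0).2.
    split=> [x y Dx Dy|t x].
      apply: le_inf_add => // _ _ [a Aa ->] [b Ab ->].
      have [/asboolP ab|/asboolP ba] := Atot _ _ Aa Ab.
        apply: le_trans (Elb _ _ (D_add Dx Dy) Ab) _.
        by have := (svalP b).1.1 _ _ Dx Dy; have := ab _ Dx; lra.
      apply: le_trans (Elb _ _ (D_add Dx Dy) Aa) _.
      by have := (svalP a).1.1 _ _ Dx Dy; have := ba _ Dy; lra.
    rewrite le_eqVlt => /predU1P[<- Dx|tp Dx].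
      rewrite scale0r mul0r -[RHS](inf1 0); congr inf; apply/seteqP; split.
        by move=> _ [a Aa ->] /=; exact: (sublinear0 Dx (svalP a).1).
      by move=> _ ->; exists a0 => //; rewrite (sublinear0 Dx (svalP a0).1).
    apply/eqP; rewrite eq_le Ez//= -ler_pdivlMl//.
    have := Ez t^-1 (t *: x); rewrite invr_gt0 scalerA mulVf ?gt_eqF// scale1r.
    by apply => //; exact: D_scale.
  by exists (exist P _ sE) => a Aa; apply/asboolP => x Dx /=; exact: Elb.
case: q qmax => q [sq qp'] qmax.
have qadd x y : D x -> D y -> q (x + y) = q x + q y.
  move=> Dx Dy; apply/eqP; rewrite eq_le sq.1//=.
  have st : sublinear (tilt q y) /\ forall z, D z -> tilt q y z <= p' z.
    split; first exact: tilt_sublinear.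
    by move=> z Dz; exact/(le_trans (tilt_le_self sq Dy Dz))/qp'.
  have /asboolP/(_ x Dx) /= : r (exist P _ st) (exist P q (conj sq qp')).
    by apply: qmax; apply/asboolP => z Dz /=; exact: tilt_le_self.
  by have := tilt_le sq Dy Dx ler01; rewrite scale1r mul1r; lra.
exists q; split => // [x Dx|].
  exact/(le_trans (qp' x Dx))/tilt_le_self.
have := tilt_le sp Dw (D_opp Dw) ler01; rewrite scale1r addNr.
rewrite (sublinear0 Dw sp).
have := qp' _ (D_opp Dw); have := qadd _ _ Dw (D_opp Dw).
by rewrite subrr (sublinear0 Dw sq) /p'; lra.
Qed.

End HahnBanach.

(** * Riesz space arithmetic *)

Section BanachLatticeTheory.
Variables (R : realType) (V : completeNormedModType R) (BL : BanachLattice V).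

Local Notation "x ≼ y" := (bl_le BL x y) (at level 70).
Local Notation lub A s := (is_lubP (bl_le BL) A s).

Lemma ble_refl x : x ≼ x. Proof. exact: bl_refl. Qed.

Lemma ble_trans y x z : x ≼ y -> y ≼ z -> x ≼ z. Proof. exact: bl_trans. Qed.

Lemma ble_sub0 x y : 0 ≼ y - x <-> x ≼ y.
Proof.
split=> [/(bl_add x)|/(bl_add (- x))]; first by rewrite add0r subrK.
by rewrite subrr.
Qed.

Lemma ble_subl x y z : x - y ≼ z <-> x ≼ z + y.
Proof. by split=> [/(bl_add y)|/(bl_add (- y))]; rewrite ?subrK ?addrK. Qed.

Lemma ble_subr x y z : x ≼ z - y <-> x + y ≼ z.
Proof. by split=> [/(bl_add y)|/(bl_add (- y))]; rewrite ?subrK ?addrK. Qed.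

Lemma ble_add2 x y x' y' : x ≼ y -> x' ≼ y' -> x + x' ≼ y + y'.
Proof.
move=> h h'; apply: (@ble_trans (y + x')); first exact: bl_add.
by rewrite [y + _]addrC [y + _]addrC; exact: bl_add.
Qed.

Lemma ble_add0 x y : 0 ≼ x -> 0 ≼ y -> 0 ≼ x + y.
Proof. by move=> x0 y0; have := ble_add2 x0 y0; rewrite addr0. Qed.

Lemma ble_opp x y : x ≼ y -> - y ≼ - x.
Proof. by move=> /ble_sub0 h; apply/ble_sub0; rewrite opprK addrC. Qed.

Lemma ble_scale (r : R) x y : 0 <= r -> x ≼ y -> r *: x ≼ r *: y.
Proof. by move=> r0 /ble_sub0/(bl_scale r0); rewrite scalerBr => /ble_sub0. Qed.

Lemma ble_addl x y : 0 ≼ y -> x ≼ x + y.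
Proof. by move=> y0; apply/ble_sub0; rewrite addrAC subrr add0r. Qed.

Lemma ble_add_double_ge0 x : 0 ≼ x + x -> 0 ≼ x.
Proof.
move=> h; have -> : x = 2^-1 *: (x + x).
  by rewrite scalerDr -scalerDl -[LHS]scale1r; congr (_ *: _); field.
by apply: bl_scale.
Qed.

Lemma bnorm_le x y : 0 ≼ x -> x ≼ y -> `|x| <= `|y|.
Proof.
have lubN z : 0 ≼ z -> lub [set v | v = z \/ v = - z]%classic z.
  move=> z0; split=> [a [|] ->|u]; [exact: ble_refl| |by apply; left].
  by apply: (@ble_trans 0) => //; rewrite -oppr0; exact: ble_opp.
by move=> x0 xy; apply: (bl_norm (lubN _ x0) (lubN _ (ble_trans x0 xy))).
Qed.

Definition babs (x : V) : V := sval (cid (bl_sup BL x (- x))).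
Definition bpos (x : V) : V := sval (cid (bl_sup BL x 0)).

Lemma babsP x : lub [set v | v = x \/ v = - x]%classic (babs x).
Proof. by rewrite /babs; case: cid. Qed.

Lemma babs_ge x : x ≼ babs x. Proof. by apply: (babsP x).1; left. Qed.
Lemma babs_geN x : - x ≼ babs x. Proof. by apply: (babsP x).1; right. Qed.

Lemma babs_le x u : x ≼ u -> - x ≼ u -> babs x ≼ u.
Proof. by move=> h h'; apply: (babsP x).2 => a [|] ->. Qed.

Lemma babs_ge0 x : 0 ≼ babs x.
Proof.
apply: ble_add_double_ge0; rewrite -(subrr x).
exact: ble_add2 (babs_ge x) (babs_geN x).
Qed.

Lemma bnorm_babs x : `|babs x| = `|x|.
Proof.
have h : lub [set v | v = babs x \/ v = - babs x]%classic (babs x).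
  split=> [a [|] ->|u]; [exact: ble_refl| |by apply; left].
  by apply: (@ble_trans 0); [rewrite -oppr0; exact/ble_opp/babs_ge0|exact: babs_ge0].
by apply/eqP; rewrite eq_le (bl_norm h (babsP x) (ble_refl _))
  (bl_norm (babsP x) h (ble_refl _)).
Qed.

Lemma bnorm_abs_le x y : x ≼ y -> - x ≼ y -> `|x| <= `|y|.
Proof.
by move=> h h'; rewrite -bnorm_babs; apply: bnorm_le; [exact: babs_ge0|exact: babs_le].
Qed.

Lemma bposP x : lub [set v | v = x \/ v = 0]%classic (bpos x).
Proof. by rewrite /bpos; case: cid. Qed.

Lemma bpos_ge x : x ≼ bpos x. Proof. by apply: (bposP x).1; left. Qed.
Lemma bpos_ge0 x : 0 ≼ bpos x. Proof. by apply: (bposP x).1; right. Qed.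

Lemma bpos_le x u : x ≼ u -> 0 ≼ u -> bpos x ≼ u.
Proof. by move=> h h'; apply: (bposP x).2 => a [|] ->. Qed.

Lemma bpos_norm x : `|bpos x| <= `|x|.
Proof.
rewrite -(bnorm_babs x); apply: bnorm_le; first exact: bpos_ge0.
by apply: bpos_le; [exact: babs_ge|exact: babs_ge0].
Qed.

Lemma bpos_eq0 x : 0 ≼ - x -> bpos x = 0.
Proof.
move=> x0; apply: bl_anti; last exact: bpos_ge0.
by apply: bpos_le; [rewrite -oppr0 -(opprK x); exact: ble_opp|exact: ble_refl].
Qed.

Lemma bpos_add x y : bpos (x + y) ≼ bpos x + bpos y.
Proof.
apply: bpos_le; first exact: ble_add2 (bpos_ge x) (bpos_ge y).
exact: ble_add0 (bpos_ge0 x) (bpos_ge0 y).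
Qed.

Lemma bpos_scale (r : R) x : 0 <= r -> bpos (r *: x) = r *: bpos x.
Proof.
have le t z : 0 <= t -> bpos (t *: z) ≼ t *: bpos z.
  move=> t0; apply: bpos_le; last exact/(bl_scale t0)/bpos_ge0.
  exact/(ble_scale t0)/bpos_ge.
rewrite le_eqVlt => /predU1P[<-|r0].
  by rewrite !scale0r bpos_eq0// oppr0; exact: ble_refl.
apply: bl_anti; first exact/le/ltW.
have rV : 0 <= r^-1 by rewrite invr_ge0 ltW.
have := ble_scale (ltW r0) (le _ (r *: x) rV).
by rewrite !scalerA mulVf ?mulfV ?gt_eqF// !scale1r.
Qed.

Lemma bpos_decomp x : x = bpos x - bpos (- x).
Proof.
suff h z : bpos z ≼ z + bpos (- z).
  apply: bl_anti; last by apply/ble_subl; exact: h.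
  apply/ble_subr; have := h (- x); rewrite opprK.
  by move/(ble_add2 (ble_refl x)); rewrite addrA subrr add0r.
apply: bpos_le; first by exact/ble_addl/bpos_ge0.
by have := ble_add2 (ble_refl z) (bpos_ge (- z)); rewrite subrr.
Qed.

(** The first part [u - bpos (u - a)] is the infimum of [u] and [a]; the rest is below [b] because
    both [u - a] and [0] are. *)
Lemma riesz_decomp u a b : 0 ≼ u -> 0 ≼ a -> 0 ≼ b -> u ≼ a + b ->
  exists u1 u2, [/\ u = u1 + u2, 0 ≼ u1, u1 ≼ a, 0 ≼ u2 & u2 ≼ b].
Proof.
move=> u0 a0 b0 uab; exists (u - bpos (u - a)), (bpos (u - a)).
split; [by rewrite subrK| | |exact: bpos_ge0|].
- by apply/ble_subr; rewrite add0r; apply: bpos_le => //; apply/ble_subl/ble_addl.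
- by apply/ble_subl; rewrite addrC; apply/ble_subl/bpos_ge.
- by apply: bpos_le => //; apply/ble_subl; rewrite addrC.
Qed.

(** The positive cone is closed: [bpos (x - y)] lies below [babs (u n - y)], whose norm can be made
    arbitrarily small. *)
Lemma ble_lim (u : nat -> V) x y :
  (forall d : R, 0 < d -> exists n, x ≼ u n /\ `|u n - y| <= d) -> x ≼ y.
Proof.
move=> h; apply/ble_sub0.
suff : bpos (x - y) = 0.
  move=> p0; have := bpos_ge (x - y); rewrite p0 => /ble_opp.
  by rewrite oppr0 opprB.
apply/eqP; rewrite -normr_le0; apply/ler_addgt0Pr => d d0; rewrite add0r.
have [n [xu un]] := h d d0.
apply: le_trans un; rewrite -(bnorm_babs (u n - y)).
apply: bnorm_le; first exact: bpos_ge0.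
apply: bpos_le; last exact: babs_ge0.
by apply: (@ble_trans (u n - y)); [exact: bl_add|exact: babs_ge].
Qed.

End BanachLatticeTheory.

(** * The lattice of positive complete orbits *)

Section Trajectories.
Variables (R : realType) (V : completeNormedModType R) (BL : BanachLattice V).
Variables (S : R -> V -> V) (t0 M : R).

Local Notation "x ≼ y" := (bl_le BL x y) (at level 70).

Hypothesis t0_ge0 : 0 <= t0.
Hypothesis S_add : forall s x y, t0 <= s -> S s (x + y) = S s x + S s y.
Hypothesis S_pos : forall s x, t0 <= s -> 0 ≼ x -> 0 ≼ S s x.
Hypothesis S_comp : forall s s' x, t0 <= s -> t0 <= s' -> S (s + s') x = S s (S s' x).
Hypothesis S_bounded : forall s x, t0 <= s -> `|S s x| <= M * `|x|.
Hypothesis M_gt0 : 0 < M.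
(** One time [r] per tolerance suffices, because a trajectory can be traced back by exactly [r] from
    any time. *)
Hypothesis S_continuous : forall e : R, 0 < e -> exists r d : R, [/\ t0 <= r, 0 < d &
  forall h x, `|h| < d -> t0 <= r + h /\ `|S (r + h) x - S r x| <= e * `|x|].

(* Complete orbits of the adjoint semigroup: [y t] is an additive functional on
   the positive cone, and [y (t + s) = S(s)' (y t)] for large [s]; values
   outside the cone are irrelevant. *)
Definition trajectory (y : R -> V -> R) :=
  (forall t u v, 0 ≼ u -> 0 ≼ v -> y t (u + v) = y t u + y t v) /\
  (forall t s u, t0 <= s -> 0 ≼ u -> y (t + s) u = y t (S s u)).

Definition bounded_by (C : R) (y : R -> V -> R) :=
  forall t u, 0 ≼ u -> y t u <= C * `|u|.

Definition positive_trajectory (y : R -> V -> R) :=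
  [/\ trajectory y, forall t u, 0 ≼ u -> 0 <= y t u & exists C, bounded_by C y].

Definition traj_le (y z : R -> V -> R) := forall t u, 0 ≼ u -> y t u <= z t u.

Definition shift (h : R) (y : R -> V -> R) (t : R) := y (t + h).

Definition traj_add (y z : R -> V -> R) t u := y t u + z t u.
Definition traj_sub (y z : R -> V -> R) t u := y t u - z t u.
Definition traj_scale (a : R) (y : R -> V -> R) t u := a * y t u.

Lemma S_sub s x y : t0 <= s -> S s (x - y) = S s x - S s y.
Proof. by move=> s0; apply/eqP; rewrite eq_sym subr_eq -S_add// subrK. Qed.

Lemma S_le s x y : t0 <= s -> x ≼ y -> S s x ≼ S s y.
Proof. by move=> s0 /ble_sub0 xy; apply/ble_sub0; rewrite -S_sub//; exact: S_pos. Qed.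

Lemma trajectory_sub y z : trajectory y -> trajectory z -> trajectory (traj_sub y z).
Proof.
move=> [ya ys] [za zs]; split=> [t u v u0 v0|t s u s0 u0]; rewrite /traj_sub.
  by rewrite ya// za//; ring.
by rewrite ys// zs.
Qed.

Lemma trajectory_add y z : trajectory y -> trajectory z -> trajectory (traj_add y z).
Proof.
move=> [ya ys] [za zs]; split=> [t u v u0 v0|t s u s0 u0]; rewrite /traj_add.
  by rewrite ya// za//; ring.
by rewrite ys// zs.
Qed.

Lemma positive_trajectory_sub y z : positive_trajectory y -> positive_trajectory z ->
  traj_le z y -> positive_trajectory (traj_sub y z).
Proof.
move=> [ty y0 [C yC]] [tz z0 _] zy; split.
- exact: trajectory_sub.
- by move=> t u u0; rewrite subr_ge0 zy.
- exists C => t u u0; apply: le_trans (yC t u u0).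
  by rewrite /traj_sub; have := z0 t u u0; lra.
Qed.

Lemma positive_trajectory_scale a y : 0 <= a ->
  positive_trajectory y -> positive_trajectory (traj_scale a y).
Proof.
move=> a0 [[ya ys] y0 [C yC]]; split.
- by split=> [t u v u0 v0|t s u s0 u0]; rewrite /traj_scale ?ya ?ys// mulrDr.
- by move=> t u u0; rewrite mulr_ge0 ?y0.
- by exists (a * C) => t u u0; rewrite -mulrA ler_wpM2l ?yC.
Qed.

Lemma positive_trajectory_shift h y :
  positive_trajectory y -> positive_trajectory (shift h y).
Proof.
move=> [[ya ys] y0 [C yC]]; split.
- split=> [t u v|t s u s0 u0]; rewrite /shift; first exact: ya.
  by rewrite addrAC (ys (t + h))//.
- by move=> t u; exact: (y0 (t + h)).
- by exists C => t u; exact: (yC (t + h)).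
Qed.

Lemma trajectory0 y t : trajectory y -> y t 0 = 0.
Proof.
move=> [ya _]; have := ya t 0 0 (ble_refl BL 0) (ble_refl BL 0).
by rewrite addr0; lra.
Qed.

Lemma trajectory_back y t s u : trajectory y -> t0 <= s -> 0 ≼ u ->
  y t u = y (t - s) (S s u).
Proof. by move=> [_ ys] s0 u0; rewrite -ys// subrK. Qed.

Lemma positive_trajectory_mono y t u v : positive_trajectory y -> 0 ≼ u -> u ≼ v ->
  y t u <= y t v.
Proof.
move=> [[ya _] y0 _] u0 uv; rewrite -(subrK u v).
have vu : 0 ≼ v - u by apply/ble_sub0.
by rewrite ya// lerDr y0.
Qed.

(** * Infima of positive trajectories *)

Definition meet_set (y z : R -> V -> R) (t : R) (x : V) : set R :=
  [set r | exists s u, [/\ t0 <= s, 0 ≼ u, u ≼ S s x &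
     r = y (t - s) u + z (t - s) (S s x - u)]]%classic.

(* The Riesz-Kantorovich infimum of [y (t - s)] and [z (t - s)], transported
   back to time [t]; it decreases with [s]. *)
Definition meet y z t x : R := inf (meet_set y z t x).

Section Meet.
Variables (y z : R -> V -> R).
Hypotheses (py : positive_trajectory y) (pz : positive_trajectory z).

Lemma meet_set_neq0 t x : 0 ≼ x -> meet_set y z t x !=set0%classic.
Proof.
move=> x0; exists (y (t - t0) 0 + z (t - t0) (S t0 x - 0)), t0, 0.
by split=> //; [exact: ble_refl|exact: S_pos].
Qed.

Lemma meet_set_ge0 t x r : 0 ≼ x -> meet_set y z t x r -> 0 <= r.
Proof.
move=> x0 [s [u [s0 u0 us ->]]]; case: py pz => _ y0 _ [_ z0 _].
by rewrite addr_ge0 ?y0 ?z0//; apply/ble_sub0.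
Qed.

Lemma meet_le_val t x s u : 0 ≼ x -> t0 <= s -> 0 ≼ u -> u ≼ S s x ->
  meet y z t x <= y (t - s) u + z (t - s) (S s x - u).
Proof.
move=> x0 s0 u0 us; apply: (@inf_le_of _ _ 0).
  by move=> r; exact: meet_set_ge0.
by exists s, u.
Qed.

Lemma meet_le_l : traj_le (meet y z) y.
Proof.
move=> t x x0; have := @meet_le_val t x t0 (S t0 x) x0 (lexx _).
rewrite subrr (trajectory0 _ (let: And3 h _ _ := pz in h)) addr0.
rewrite -trajectory_back//; last by case: py.
by apply; [exact: S_pos|exact: ble_refl].
Qed.

Lemma meet_le_r : traj_le (meet y z) z.
Proof.
move=> t x x0; have := @meet_le_val t x t0 0 x0 (lexx _).
rewrite subr0 (trajectory0 _ (let: And3 h _ _ := py in h)) add0r.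
rewrite -trajectory_back//; last by case: pz.
by apply; [exact: ble_refl|exact: S_pos].
Qed.

(** Tracing [h] back by [s] and splitting [S s x] bounds [h t x] by every member of [meet_set].
    Since [h] may change sign, this applies to differences of trajectories. *)
Lemma meet_glb h : trajectory h -> traj_le h y -> traj_le h z -> traj_le h (meet y z).
Proof.
move=> th hy hz t x x0; apply: lb_le_inf; first exact: meet_set_neq0.
move=> _ [s [u [s0 u0 us ->]]].
have us0 : 0 ≼ S s x - u by apply/ble_sub0.
rewrite (trajectory_back _ th s0 x0) -{1}(subrK u (S s x)) th.1//.
by rewrite addrC lerD ?hy ?hz.
Qed.

(** A splitting of [S s x] pushed forward by [q] keeps its value, so splittings made at different
    times can be compared at a common one. *)
Lemma meet_val_push t s q u x : t0 <= s -> t0 <= q -> 0 ≼ u -> u ≼ S s x ->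
  y (t - (q + s)) (S q u) + z (t - (q + s)) (S (q + s) x - S q u) =
  y (t - s) u + z (t - s) (S s x - u).
Proof.
move=> s0 q0 u0 us; rewrite S_comp// -S_sub//.
have us0 : 0 ≼ S s x - u by apply/ble_sub0.
have -> : t - s = t - (q + s) + q by ring.
by case: py pz => [[_ ys] _ _] [[_ zs] _ _]; rewrite (ys _ q)// (zs _ q).
Qed.

(** For subadditivity two splittings are pushed to the time [q + s] and added; for superadditivity
    [riesz_decomp] divides a splitting of the sum. For the orbit identity, a splitting of
    [S q (S s x)] is one of [S (q + s) x], and conversely a splitting of [S q x] is first pushed by
    [s]. *)
Lemma meet_trajectory : trajectory (meet y z).
Proof.
split=> [t u v u0 v0|t s x s0 x0]; apply/eqP; rewrite eq_le; apply/andP; split.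
- apply: le_inf_add; [exact: meet_set_neq0..|].
  move=> _ _ [s [a [s0 a0 au ->]]] [q [b [q0 b0 bv ->]]].
  rewrite -(meet_val_push t s0 q0 a0 au) -(meet_val_push t q0 s0 b0 bv).
  have qs : t0 <= q + s by have := t0_ge0; lra.
  rewrite [s + q]addrC.
  apply: le_trans (meet_le_val (s := q + s) (u := S q a + S s b) t _ _ _ _) _.
  + exact: ble_add0.
  + done.
  + by apply: ble_add0; exact: S_pos.
  + rewrite S_add//; apply: ble_add2; first by rewrite S_comp//; exact: S_le.
    by rewrite addrC S_comp//; exact: S_le.
  have qa : 0 ≼ S q a by exact: S_pos.
  have sb : 0 ≼ S s b by exact: S_pos.
  have e1 : 0 ≼ S (q + s) u - S q a.
    by apply/ble_sub0; rewrite S_comp//; exact: S_le.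
  have e2 : 0 ≼ S (q + s) v - S s b.
    by apply/ble_sub0; rewrite addrC S_comp//; exact: S_le.
  rewrite S_add// [- (_ + S s b)]opprD addrACA.
  case: py pz => [[ya _] _ _] [[za _] _ _].
  by rewrite ya// (za _ _ _ e1 e2); lra.
- apply: lb_le_inf; first exact/meet_set_neq0/ble_add0.
  move=> _ [s [a [s0 a0 auv ->]]]; rewrite S_add// in auv *.
  have [b [c [-> b0 bu c0 cv]]] := riesz_decomp a0 (S_pos s0 u0) (S_pos s0 v0) auv.
  have := meet_le_val t u0 s0 b0 bu; have := meet_le_val t v0 s0 c0 cv.
  have e1 : 0 ≼ S s u - b by apply/ble_sub0.
  have e2 : 0 ≼ S s v - c by apply/ble_sub0.
  rewrite opprD addrACA; case: py pz => [[ya _] _ _] [[za _] _ _].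
  by rewrite ya// (za _ _ _ e1 e2); lra.
- apply: lb_le_inf; first exact/meet_set_neq0/S_pos.
  move=> _ [q [a [q0 a0 ax ->]]]; rewrite -S_comp// in ax *.
  have -> : t - q = t + s - (q + s) by ring.
  apply: meet_le_val => //.
  by have := t0_ge0; lra.
- apply: lb_le_inf; first exact/meet_set_neq0.
  move=> _ [q [a [q0 a0 ax ->]]].
  rewrite -(meet_val_push _ q0 s0 a0 ax).
  have -> : t + s - (s + q) = t - q by ring.
  rewrite [s + q]addrC S_comp//.
  apply: meet_le_val => //; first exact: S_pos.
  + exact: S_pos.
  + rewrite -S_comp// addrC S_comp//; exact: S_le.
Qed.

Lemma meet_positive : positive_trajectory (meet y z).
Proof.
split; first exact: meet_trajectory.
  move=> t u u0; apply: lb_le_inf; first exact: meet_set_neq0.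
  by move=> r; exact: meet_set_ge0.
case: py => _ _ [C yC]; exists C => t u u0.
by apply: le_trans (yC t u u0); exact: meet_le_l.
Qed.

End Meet.

(** * Disjoint trajectories and small time shifts *)

Definition disjoint (a b : R -> V -> R) := forall h, positive_trajectory h ->
  traj_le h a -> traj_le h b -> forall t u, 0 ≼ u -> h t u <= 0.

(** Since [c - b] is a lower bound of [c] and [a], the excess of [c] over [meet c a] lies below [b].
    It also lies below [c], so disjointness makes it vanish. *)
Lemma disjoint_le_add a b c : positive_trajectory a -> positive_trajectory b ->
  positive_trajectory c -> traj_le c (traj_add a b) -> disjoint c b -> traj_le c a.
Proof.
move=> pa pb pc cab cb t u u0.
have cm : traj_le (traj_sub c b) (meet c a).
  apply: meet_glb => //; first by apply: trajectory_sub; [case: pc|case: pb].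
    move=> q x x0; rewrite /traj_sub; case: pb => _ b0 _.
    by have := b0 q x x0; lra.
  by move=> q x x0; have := cab q x x0; rewrite /traj_sub /traj_add; lra.
have lem : traj_le (meet c a) c by exact: meet_le_l.
have : traj_sub c (meet c a) t u <= 0.
  apply: cb => //.
  - by apply: positive_trajectory_sub => //; exact: meet_positive.
  - move=> q x x0; rewrite /traj_sub.
    by have [_ m0 _] := meet_positive pc pa; have := m0 q x x0; lra.
  - by move=> q x x0; have := cm q x x0; rewrite /traj_sub; lra.
rewrite /traj_sub; have := @meet_le_r c a pc pa t u u0; lra.
Qed.

Lemma le0_geometric (x K q : R) : 0 <= q < 1 -> (forall n, x <= K * q ^+ n) -> x <= 0.
Proof.
move=> /andP[q0 q1] h.
have cv : (geometric K q @ \oo --> (0 : R)%R)%classic by apply: cvg_geometric; rewrite ger0_norm.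
rewrite -(cvg_lim _ cv)//; apply: limr_ge; first by apply/cvg_ex; exists 0.
by apply: nearW => n; exact: h.
Qed.

(** As the infimum of [y] and its shift is zero, some splitting [S s x = u + b] makes [y] small on
    [u] and the shifted [y] small on [b]. On [b], norm continuity lets [y] exceed its shift by at
    most half of the original bound. *)
Lemma bounded_by_halve : exists2 d : R, 0 < d & forall h y C, `|h| < d ->
  positive_trajectory y -> disjoint y (shift h y) -> 0 <= C ->
  bounded_by C y -> bounded_by (C / 2) y.
Proof.
(* The norm of [b] will be at most [M] times that of [x]; the factor [(2 * M)^-1] turns this into
   one half. *)
have e0 : 0 < (2 * M)^-1 by rewrite invr_gt0 mulr_gt0.
have [r [d [r0 d0 rd]]] := S_continuous e0.
exists d => // h y C hd py dy C0 yC t x x0.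
have psy := positive_trajectory_shift h py.
have m0 : meet y (shift h y) t x <= 0.
  by apply: dy => //; [exact: meet_positive|exact: meet_le_l|exact: meet_le_r].
apply/ler_addgt0Pr => e eps0.
have [_ [s [u [s0 u0 us ->]]] le_e] : exists2 v, meet_set y (shift h y) t x v & v < e.
  by apply: inf_lt; [exact: meet_set_neq0|exact: le_lt_trans m0 eps0].
set b := S s x - u in le_e.
have b0 : 0 ≼ b by apply/ble_sub0.
have ty : trajectory y by case: py.
have y0 : 0 <= y (t - s) u by case: py => _ y0 _; exact: y0.
have sy0 : 0 <= shift h y (t - s) b by case: psy => _ y1 _; exact: y1.
have -> : y t x = y (t - s) u + y (t - s) b.
  by rewrite (trajectory_back _ ty s0)// -ty.1// [u + b]addrC /b subrK.
have [rh0 le_b] := rd h b hd.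
(* Both values are traced back to the same time [t - s - r], so that only [S r b] and [S (r + h) b]
   differ. *)
have yb : y (t - s) b = y (t - s - r) (S r b) by rewrite -trajectory_back.
have syb : shift h y (t - s) b = y (t - s - r) (S (r + h) b).
  by rewrite -ty.2// /shift; congr y; ring.
have : y (t - s) b <= shift h y (t - s) b + C * ((2 * M)^-1 * (M * `|x|)).
  rewrite yb syb; set k := y _.
  have p0 := bpos_ge0 BL (S r b - S (r + h) b).
  apply: le_trans (_ : k (S (r + h) b + bpos BL (S r b - S (r + h) b)) <= _).
    apply: positive_trajectory_mono => //; first exact: S_pos.
    by rewrite addrC; apply/ble_subl/bpos_ge.
  rewrite /k ty.1//; last exact: S_pos.
  rewrite lerD2l; apply: le_trans (yC _ _ p0) _; rewrite ler_wpM2l//.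
  apply: le_trans (bpos_norm _ _) _; rewrite distrC; apply: le_trans le_b _.
  rewrite ler_wpM2l ?(ltW e0)//; apply: le_trans (S_bounded x s0).
  apply: (bnorm_le b0); apply/ble_subl; exact: ble_addl.
have -> : C * ((2 * M)^-1 * (M * `|x|)) = C / 2 * `|x|.
  by field; rewrite gt_eqF.
by lra.
Qed.

(** The [d] of [bounded_by_halve] depends neither on [y] nor on the bound, so the halving can be
    iterated. *)
Lemma shift_rigid : exists2 d : R, 0 < d & forall h y, `|h| < d ->
  positive_trajectory y -> disjoint y (shift h y) -> forall t u, 0 ≼ u -> y t u <= 0.
Proof.
have [d d0 hd] := bounded_by_halve; exists d => // h y hh py dy t u u0.
have [_ _ [C yC]] := py.
suff bd n : bounded_by (`|C| * 2^-1 ^+ n) y.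
  apply: (@le0_geometric _ (`|C| * `|u|) 2^-1); first by apply/andP; split; lra.
  by move=> n; rewrite mulrAC; exact: bd.
elim: n => [|n IH].
  move=> q x x0; rewrite expr0 mulr1; apply: le_trans (yC q x x0) _.
  by rewrite ler_wpM2r// ler_norm.
by rewrite exprSr mulrA; apply: (hd h) => //; rewrite mulr_ge0// exprn_ge0.
Qed.

Section SmallShift.
Variable d : R.
Hypothesis d_rigid : forall h y, `|h| < d -> positive_trajectory y ->
  disjoint y (shift h y) -> forall t u, 0 ≼ u -> y t u <= 0.

Lemma disjoint_shift h a b : `|h| < d -> positive_trajectory a ->
  disjoint a b -> disjoint (shift h a) b.
Proof.
move=> hd pa ab k pk ka kb t u u0; apply: (d_rigid (h := - h)) => //.
  by rewrite normrN.
(* A common lower bound [l] of [k] and [shift (- h) k] is below [b] through [k], and below [a]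
   because shifting back undoes the shift of [a]. *)
move=> l pl lk lk' q x x0; apply: ab => //.
  move=> p v v0; apply: le_trans (lk' _ _ v0) _; rewrite /shift.
  by have := ka (p - h) v v0; rewrite /shift subrK.
by move=> p v v0; exact/(le_trans (lk p v v0))/kb.
Qed.

(* Let [w = (c f - U f)^+] and [v = (U f - c f)^+] with [U = shift h]. Since all
   [U^n w] are disjoint from [v], induction yields [U^n w <= c^n f], and as
   [U^(-n) f] is bounded, [w = 0]. *)
Lemma scale_le_shift h c f : `|h| < d -> 0 < c < 1 -> positive_trajectory f ->
  traj_le (traj_scale c f) (shift h f).
Proof.
move=> hd /andP[c0 c1] pf.
set g := traj_scale c f; have pg : positive_trajectory g.
  exact/positive_trajectory_scale/pf/ltW.
have psf := positive_trajectory_shift h pf.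
set m := meet g (shift h f); have pm : positive_trajectory m by exact: meet_positive.
have mg : traj_le m g by exact: meet_le_l.
have msf : traj_le m (shift h f) by exact: meet_le_r.
pose w := traj_sub g m; pose v := traj_sub (shift h f) m.
have pw : positive_trajectory w by exact: positive_trajectory_sub.
have pv : positive_trajectory v by exact: positive_trajectory_sub.
have wv : disjoint w v.
  move=> k pk kw kv t u u0.
  (* Adding [m] to a common lower bound of [w] and [v] gives a lower bound of [g] and [shift h f],
     hence at most their infimum [m]. *)
  have : traj_le (traj_add k m) m.
    apply: meet_glb => //; first by apply: trajectory_add; [case: pk|case: pm].
      by move=> q x x0; have := kw q x x0; rewrite /w /traj_sub /traj_add; lra.
    by move=> q x x0; have := kv q x x0; rewrite /v /traj_sub /traj_add; lra.
  by move=> /(_ t u u0); rewrite /traj_add; lra.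
have shiftS n : shift (n.+1%:R * h) w = shift h (shift (n%:R * h) w).
  by apply/funext => t; rewrite /shift; congr w; rewrite -addn1 natrD; ring.
have sh n : disjoint (shift (n%:R * h) w) v.
  elim: n => [|n IH]; last first.
    by rewrite shiftS; apply: disjoint_shift => //; exact: positive_trajectory_shift.
  by rewrite mul0r (_ : shift 0 w = w)//; apply/funext => t; rewrite /shift addr0.
have le n : traj_le (shift (n%:R * h) w) (traj_scale (c ^+ n) f).
  elim: n => [|n IH].
    move=> t u u0; rewrite /shift /traj_scale mul0r addr0 expr0 mul1r /w /traj_sub.
    have [_ m0 _] := pm; have [_ f0 _] := pf.
    rewrite /g /traj_scale; have := m0 t u u0.
    have := f0 t u u0; nra.
  have cn0 : 0 <= c ^+ n by rewrite exprn_ge0// ltW.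
  have cn1 : c ^+ n <= 1 by rewrite exprn_ile1// ltW.
  have [_ v0 _] := pv.
  (* Shifting the induction hypothesis bounds the next shift of [w] by [c ^+ n] times [m + v], where
     [m] is at most [c] times [f]. Disjointness from [v] discards the second term. *)
  apply: (@disjoint_le_add _ (traj_scale (c ^+ n) v)).
  - by apply: positive_trajectory_scale => //; rewrite exprn_ge0// ltW.
  - exact: positive_trajectory_scale.
  - exact: positive_trajectory_shift.
  - move=> t u u0; rewrite shiftS; apply: le_trans (IH (t + h) u u0) _.
    rewrite /traj_add /traj_scale exprSr -mulrA -mulrDr ler_wpM2l//.
    have -> : f (t + h) u = m t u + v t u by rewrite /v /traj_sub /shift; ring.
    by rewrite lerD2r; exact: mg.
  - move=> k pk kw kv; apply: (sh n.+1) => // t u u0.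
    apply: le_trans (kv t u u0) _; rewrite /traj_scale ler_piMl//; exact: v0.
move=> t u u0; apply: le_trans (msf t u u0).
have [_ _ [C fC]] := pf.
rewrite -subr_le0; apply: (@le0_geometric _ (C * `|u|) c); first by rewrite (ltW c0).
(* Evaluating the [n]-th shift at [t - n%:R * h] gives [w t u] itself, while the bound on [f] is
   uniform in time. *)
move=> n; have := le n (t - n%:R * h) u u0; rewrite /shift subrK => /le_trans; apply.
rewrite /traj_scale mulrC ler_wpM2r ?exprn_ge0 ?(ltW c0)//; exact: fC.
Qed.

Lemma le_shift h f : `|h| < d -> positive_trajectory f -> traj_le f (shift h f).
Proof.
move=> hd pf t u u0; rewrite leNgt; apply/negP => lt.
have [_ f0 _] := pf; have b0 : 0 <= shift h f t u by exact: (f0 (t + h)).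
set a := f t u in lt *; set b := shift h f t u in lt b0 *.
have a0 : 0 < a by lra.
(* For this [c] the product [c * a] is the midpoint of [a] and [b], which would exceed [b]. *)
have c01 : 0 < (a + b) / 2 / a < 1.
  by rewrite divr_gt0 ?ltr_pdivrMr ?mul1r//=; lra.
have := scale_le_shift hd c01 pf t u0; rewrite /traj_scale -/a -/b.
by rewrite divfK ?gt_eqF//; lra.
Qed.

Lemma shift_small h f t u : `|h| < d -> positive_trajectory f -> 0 ≼ u ->
  f (t + h) u = f t u.
Proof.
move=> hd pf u0; apply/eqP; rewrite eq_le; apply/andP; split; last exact: le_shift.
have hN : `|- h| < d by rewrite normrN.
by have := le_shift hN pf (t + h) u0; rewrite /shift addrK.
Qed.

End SmallShift.

Lemma positive_trajectory_const f t h u : positive_trajectory f -> 0 ≼ u ->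
  f (t + h) u = f t u.
Proof.
move=> pf u0; have [d d0 rd] := shift_rigid.
(* The shift by [h] is cut into [n.+1] equal steps shorter than [d]. *)
pose n := Num.truncn (`|h| / d).
have nh : `|h / n.+1%:R| < d.
  rewrite normrM normfV (ger0_norm (ler0n _ _)) ltr_pdivrMr// mulrC -ltr_pdivrMr//.
  exact: truncnS_gt.
have step k : f (t + k%:R * (h / n.+1%:R)) u = f t u.
  elim: k => [|k <-]; first by rewrite mul0r addr0.
  rewrite -[RHS](shift_small rd _ nh)//; congr f; rewrite -addn1 natrD; ring.
by rewrite -[RHS](step n.+1) mulrC divfK ?pnatr_eq0.
Qed.

(** * Long-time differences of orbits *)

Definition eventually_bounded (g : R -> V) :=
  exists C T, forall q, T <= q -> `|g q| <= C.

Definition limsup_pos (g : R -> V) : R :=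
  inf [set c | exists T, forall q, T <= q -> `|bpos BL (g q)| <= c]%classic.

Lemma eventually_bounded_add g g' : eventually_bounded g -> eventually_bounded g' ->
  eventually_bounded (g + g').
Proof.
move=> [C [T h]] [C' [T' h']]; exists (C + C'), (Num.max T T') => q.
rewrite ge_max => /andP[q1 q2].
by apply: le_trans (ler_normD _ _) _; rewrite lerD ?h ?h'.
Qed.

Lemma eventually_bounded_scale (a : R) g : eventually_bounded g -> eventually_bounded (a *: g).
Proof.
move=> [C [T h]]; exists (`|a| * C), T => q Tq.
have -> : (a *: g) q = a *: g q by [].
by rewrite normrZ ler_wpM2l ?h.
Qed.

Lemma limsup_pos_le g c T : (forall q, T <= q -> `|bpos BL (g q)| <= c) ->
  limsup_pos g <= c.
Proof.
move=> h; apply: (@inf_le_of _ _ 0); last by exists T.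
by move=> a [T' /(_ T' (lexx _))]; exact: le_trans.
Qed.

Lemma limsup_pos_neq0 g : eventually_bounded g ->
  [set c | exists T, forall q, T <= q -> `|bpos BL (g q)| <= c]%classic !=set0%classic.
Proof.
by move=> [C [T h]]; exists C, T => q /h; exact/le_trans/bpos_norm.
Qed.

Lemma limsup_pos_ge0 g : eventually_bounded g -> 0 <= limsup_pos g.
Proof.
move=> bg; apply: lb_le_inf; first exact: limsup_pos_neq0.
by move=> c [T /(_ T (lexx _))]; exact: le_trans.
Qed.

Lemma limsup_pos_lt g c : eventually_bounded g -> limsup_pos g < c ->
  exists T, forall q, T <= q -> `|bpos BL (g q)| <= c.
Proof.
move=> /limsup_pos_neq0 h /(inf_lt h)[b [T hb] /ltW bc].
by exists T => q /hb /le_trans; exact.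
Qed.

Lemma limsup_pos_sublinear : sublinear eventually_bounded limsup_pos.
Proof.
have le a g : 0 < a -> eventually_bounded g -> limsup_pos (a *: g) <= a * limsup_pos g.
  move=> a0 bg; rewrite -ler_pdivrMl//; apply: lb_le_inf; first exact: limsup_pos_neq0.
  move=> c [T h]; rewrite ler_pdivrMl//; apply: (@limsup_pos_le _ _ T) => q /h.
  have -> : (a *: g) q = a *: g q by [].
  by rewrite (bpos_scale _ _ (ltW a0)) normrZ gtr0_norm// ler_pM2l.
split=> [g g' bg bg'|a g].
  apply: le_inf_add; [exact: limsup_pos_neq0..|].
  move=> c c' [T h] [T' h']; apply: (@limsup_pos_le _ _ (Num.max T T')) => q.
  rewrite ge_max => /andP[q1 q2]; apply: le_trans (lerD (h q q1) (h' q q2)).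
  apply: le_trans (ler_normD _ _); apply: bnorm_le; first exact: bpos_ge0.
  exact: bpos_add.
rewrite le_eqVlt => /predU1P[<- bg|a0 bg].
  rewrite scale0r mul0r; apply/eqP; rewrite eq_le limsup_pos_ge0 ?andbT.
    apply: (@limsup_pos_le _ _ 0) => q _.
    by rewrite bpos_eq0 ?normr0//; rewrite oppr0; exact: ble_refl.
  by exists 0, 0 => q _; rewrite normr0.
apply/eqP; rewrite eq_le le//= -ler_pdivlMl//.
have := le a^-1 (a *: g); rewrite invr_gt0 scalerA mulVf ?gt_eqF// scale1r.
by apply => //; exact: eventually_bounded_scale.
Qed.

Definition orbit (u : V) (t q : R) : V := S (q + t) u.

Lemma orbit_bound u t : forall q, t0 - t <= q -> `|orbit u t q| <= M * `|u|.
Proof. by move=> q h; apply: S_bounded; lra. Qed.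

Lemma orbit_bounded u t : eventually_bounded (orbit u t).
Proof. by exists (M * `|u|), (t0 - t); exact: orbit_bound. Qed.

(* A functional dominated by [limsup_pos] turns the orbits into a positive
   trajectory, which is constant, so [limsup_pos] vanishes on differences. *)
Lemma limsup_pos_orbit_le0 u a b : 0 ≼ u -> limsup_pos (orbit u a - orbit u b) <= 0.
Proof.
move=> u0; set w := orbit u a - orbit u b.
have bN g : eventually_bounded g -> eventually_bounded (- g).
  by rewrite -scaleN1r; exact: eventually_bounded_scale.
have bw : eventually_bounded w.
  by apply: eventually_bounded_add; [|apply: bN]; exact: orbit_bounded.
have [F [Fadd Fle Fw]] := hahn_banach eventually_bounded_add
  eventually_bounded_scale limsup_pos_sublinear bw.
apply: le_trans Fw _.
have F0 : F 0 = 0.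
  have b0 : eventually_bounded 0 by exists 0, 0 => q _; rewrite normr0.
  by have := Fadd 0 0 b0 b0; rewrite addr0; lra.
have FN g : eventually_bounded g -> F (- g) = - F g.
  by move=> bg; have := Fadd g (- g) bg (bN _ bg); rewrite subrr F0; lra.
have Fpos g T : eventually_bounded g -> (forall q, T <= q -> 0 ≼ g q) -> 0 <= F g.
  move=> bg gT; rewrite -oppr_le0 -FN//.
  apply: le_trans (Fle _ (bN _ bg)) _; apply: (@limsup_pos_le _ _ T) => q /gT g0.
  by rewrite bpos_eq0 ?normr0// opprK.
(* [F] sees only the tail of a function. This matters because the semigroup identities for [S] hold
   only at times beyond [t0]. *)
have Feq g g' T : eventually_bounded g -> eventually_bounded g' ->
    (forall q, T <= q -> g q = g' q) -> F g = F g'.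
  move=> bg bg' gg'; have bd : eventually_bounded (g - g').
    by apply: eventually_bounded_add => //; exact: bN.
  have FB : F g - F g' = F (g - g') by rewrite Fadd ?FN//; exact: bN.
  have h1 : 0 <= F (g - g').
    apply: (Fpos _ T) => // q /gg' e; rewrite [X in bl_le _ _ X](_ : _ = 0); first exact: ble_refl.
    by apply/eqP; rewrite subr_eq0 e.
  have h2 : 0 <= F (- (g - g')).
    apply: (Fpos _ T) => [|q /gg' e]; first exact: bN.
    rewrite [X in bl_le _ _ X](_ : _ = 0); first exact: ble_refl.
    by apply/eqP; rewrite oppr_eq0 subr_eq0 e.
  by rewrite FN// in h2; lra.
pose y t v := F (orbit v t).
have py : positive_trajectory y.
  split; [split|..].
  - move=> t v v' v0 v'0; rewrite /y -Fadd; [|exact: orbit_bounded..].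
    apply: (Feq _ _ (t0 - t)); first exact: orbit_bounded.
      by apply: eventually_bounded_add; exact: orbit_bounded.
    by move=> q h; rewrite /orbit S_add//; lra.
  - move=> t s v s0 v0; apply: (Feq _ _ (t0 - t)); [exact: orbit_bounded..|].
    by move=> q h; rewrite /orbit addrA (S_comp (s := q + t) (s' := s))//; lra.
  - move=> t v v0; apply: (Fpos _ (t0 - t)); first exact: orbit_bounded.
    by move=> q h; apply: S_pos => //; lra.
  - exists M => t v v0; apply: le_trans (Fle _ (orbit_bounded v t)) _.
    apply: (@limsup_pos_le _ _ (t0 - t)) => q /(orbit_bound v); apply: le_trans.
    exact: bpos_norm.
have -> : F w = y a u - y b u.
  by rewrite /w Fadd ?FN//; [exact: orbit_bounded..|apply: bN; exact: orbit_bounded].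
have := positive_trajectory_const b (a - b) py u0.
by rewrite [b + _]addrC subrK => ->; rewrite subrr.
Qed.

(** Exchanging [a] and [b] controls the negative part of the difference too; a general [x] is the
    difference of two positive vectors. *)
Lemma asymptotically_constant x a b e : 0 < e ->
  exists T, forall q, T <= q -> `|S (q + a) x - S (q + b) x| <= e.
Proof.
have bw u c c' : eventually_bounded (orbit u c - orbit u c').
  apply: eventually_bounded_add; first exact: orbit_bounded.
  by rewrite -scaleN1r; apply: eventually_bounded_scale; exact: orbit_bounded.
have pos u d : 0 ≼ u -> 0 < d ->
    exists T, forall q, T <= q -> `|S (q + a) u - S (q + b) u| <= d.
  move=> u0 d0; have d2 : 0 < d / 2 by lra.
  have [T1 h1] := limsup_pos_lt (bw u a b) (le_lt_trans (limsup_pos_orbit_le0 a b u0) d2).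
  have [T2 h2] := limsup_pos_lt (bw u b a) (le_lt_trans (limsup_pos_orbit_le0 b a u0) d2).
  exists (Num.max T1 T2) => q; rewrite ge_max => /andP[q1 q2].
  rewrite [X in `|X|](bpos_decomp BL) opprB; apply: le_trans (ler_normB _ _) _.
  by have := lerD (h1 q q1) (h2 q q2); rewrite -splitr.
move=> e0; have e2 : 0 < e / 2 by lra.
have [T1 h1] := pos _ _ (bpos_ge0 BL x) e2.
have [T2 h2] := pos _ _ (bpos_ge0 BL (- x)) e2.
exists (Num.max (Num.max T1 T2) (Num.max (t0 - a) (t0 - b))) => q.
rewrite !ge_max => /andP[/andP[q1 q2] /andP[q3 q4]].
have qa : t0 <= q + a by lra.
have qb : t0 <= q + b by lra.
rewrite {1 2}(bpos_decomp BL x) !S_sub// opprD addrACA -opprD.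
apply: le_trans (ler_normB _ _) _.
by have := lerD (h1 q q1) (h2 q q2); rewrite -splitr.
Qed.

End Trajectories.

(** * The norm of the complexification *)

Lemma le_div_nat (R : realType) (K e : R) : 0 <= K -> 0 < e ->
  exists N, forall n, (N <= n)%N -> K / n.+1%:R <= e.
Proof.
move=> K0 e0; exists (Num.truncn (K / e)) => n Nn.
rewrite ler_pdivrMr// mulrC -ler_pdivrMr//; apply/ltW/(lt_le_trans (truncnS_gt _)).
by rewrite ler_nat.
Qed.

Lemma cauchy_seq_lim (R : realType) (V : completeNormedModType R) (u : nat -> V) :
  (forall e : R, 0 < e -> exists N, forall m n, (N <= m)%N -> (N <= n)%N ->
    `|u m - u n| <= e) ->
  exists l, forall e : R, 0 < e -> exists N, forall n, (N <= n)%N -> `|u n - l| <= e.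
Proof.
move=> h.
have /cauchy_cvgP/cvg_ex[l ul] : cauchy (u @ \oo)%classic.
  apply: cauchy_exP => e e0; have e2 : 0 < e / 2 by lra.
  have [N hN] := h _ e2; exists (u N); exists N => // n /= Nn.
  rewrite -ball_normE /=; apply: le_lt_trans (hN _ _ (leqnn N) Nn) _; lra.
exists l => e e0; move/cvgrPdist_le : ul => /(_ e e0)[N _ hN].
by exists N => n Nn; rewrite distrC; exact: hN.
Qed.

Section ComplexModulus.
Variables (R : realType) (V : completeNormedModType R) (BL : BanachLattice V).

Local Notation "x ≼ y" := (bl_le BL x y) (at level 70).

Lemma finite_lub (l : seq V) : l != [::] ->
  exists s, is_lubP (bl_le BL) [set v | v \in l]%classic s.
Proof.
elim: l => // a [|b l] IH _.
  exists a; split=> [v|u]; first by rewrite /= inE => /eqP ->; exact: ble_refl.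
  by apply; rewrite /= mem_head.
have [//|s [s1 s2]] := IH; have [c [c1 c2]] := bl_sup BL a s.
exists c; split=> [v /=|u hu].
  rewrite inE => /orP[/eqP ->|vl]; first by apply: c1; left.
  by apply: (ble_trans (s1 v vl)); apply: c1; right.
apply: c2 => _ [->|->]; first by apply: hu; rewrite /= mem_head.
by apply: s2 => v /= vl; apply: hu; rewrite /= inE vl orbT.
Qed.

Lemma scale_le_babs (a : R) x : a *: x ≼ `|a| *: babs BL x.
Proof.
have [a0|a0] := leP 0 a; first by rewrite ger0_norm//; apply: ble_scale => //; exact: babs_ge.
rewrite ltr0_norm// -[X in bl_le _ X _]opprK -scalerN -scaleNr.
by apply: ble_scale; [lra|exact: babs_geN].
Qed.

Section Existence.
Variable z : V * V.

Let e := babs BL z.1 + babs BL z.2.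
Let pt (th : R) := cos th *: z.1 + sin th *: z.2.
(** A grid of squares of side [n.+1%:R^-1] for the point with coordinates [cos th] and [sin th],
    moved by 1 so that truncation acts on nonnegative numbers. [node] picks one angle per occupied
    square, and [0] for an empty one. *)
Let cell n (th : R) := (Num.truncn (n.+1%:R * (cos th + 1)), Num.truncn (n.+1%:R * (sin th + 1))).
Let node n (c : nat * nat) : R := xget 0 [set th | cell n th = c]%classic.

Lemma cell_near n th : let th' := node n (cell n th) in
  `|cos th - cos th'| <= n.+1%:R^-1 /\ `|sin th - sin th'| <= n.+1%:R^-1.
Proof.
have H (a b : R) : -1 <= a -> -1 <= b ->
    Num.truncn (n.+1%:R * (a + 1)) = Num.truncn (n.+1%:R * (b + 1)) -> `|a - b| <= n.+1%:R^-1.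
  move=> a1 b1 ab; have n0 : 0 < n.+1%:R :> R by [].
  have pos (c : R) : -1 <= c -> 0 <= n.+1%:R * (c + 1) by move=> c1; rewrite mulr_ge0//; lra.
  have /andP[h1 h2] := truncn_itv (pos a a1); have /andP[h3 h4] := truncn_itv (pos b b1).
  rewrite -ab in h3 h4; rewrite -[n.+1%:R^-1]mul1r ler_pdivlMr//.
  have : `|(a - b) * n.+1%:R| <= 1.
    set k := Num.truncn _ in h1 h2 h3 h4.
    rewrite -[k.+1]addn1 natrD in h2 h4.
    by rewrite ler_norml; apply/andP; split; lra.
  by rewrite normrM (ger0_norm (ltW n0)).
have : cell n (node n (cell n th)) = cell n th.
  exact: (@xgetPex _ 0 [set t | cell n t = cell n th]%classic (ex_intro _ th erefl)).
by case => h1 h2; split; apply: H; rewrite ?cos_geN1 ?sin_geN1.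
Qed.

Lemma cell_bound n th : ((cell n th).1 <= 2 * n.+1)%N /\ ((cell n th).2 <= 2 * n.+1)%N.
Proof.
have H (a : R) : -1 <= a -> a <= 1 -> (Num.truncn (n.+1%:R * (a + 1)) <= 2 * n.+1)%N.
  move=> a1 a2; have p : 0 <= n.+1%:R * (a + 1) :> R by rewrite mulr_ge0//; lra.
  have /andP[h1 _] := truncn_itv p; rewrite -(@ler_nat R); apply: (le_trans h1).
  by rewrite natrM mulrC ler_wpM2r//; lra.
by split; apply: H; rewrite ?cos_geN1 ?sin_geN1 ?cos_le1 ?sin_le1.
Qed.

(** The supremum [s n] over the finitely many nodes is below every upper bound of the circle of
    points, and [s n + n.+1%:R^-1 *: e] is itself such a bound. Hence [s n] is Cauchy and its limit
    is the supremum, so [cmod] never falls back on its default. *)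
Lemma cmod_lub : is_lubP (bl_le BL) (cmod_set z) (cmod BL z).
Proof.
apply: xgetPex.
pose l n := [seq pt (node n c) |
  c <- [seq (i, j) | i <- iota 0 (2 * n.+1).+1, j <- iota 0 (2 * n.+1).+1]].
have l0 n : l n != [::] by [].
have [s hs] := @choice _ _ _ (fun n => finite_lub (l0 n)).
have ub n v : cmod_set z v -> v ≼ s n + n.+1%:R^-1 *: e.
  move=> [th ->]; have [h1 h2] := cell_near n th; have [b1 b2] := cell_bound n th.
  set th' := node n (cell n th) in h1 h2.
  have : pt th' ≼ s n.
    apply: (hs n).1; rewrite /= /l; apply/mapP; exists (cell n th) => //.
    by rewrite [cell n th]surjective_pairing; apply: allpairs_f; rewrite mem_iota/= add0n ltnS.
  move=> hp; rewrite [X in bl_le _ X _](_ : _ =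
    pt th' + ((cos th - cos th') *: z.1 + (sin th - sin th') *: z.2)); last first.
    by rewrite /pt !scalerBl addrACA !(addrC _ (_ - _)) !subrK.
  apply: ble_add2 => //; rewrite /e scalerDr; apply: ble_add2.
    apply: ble_trans (scale_le_babs _ _) _; apply/ble_sub0; rewrite -scalerBl.
    by apply: bl_scale; [rewrite subr_ge0|exact: babs_ge0].
  apply: ble_trans (scale_le_babs _ _) _; apply/ble_sub0; rewrite -scalerBl.
  by apply: bl_scale; [rewrite subr_ge0|exact: babs_ge0].
have lb n u : (forall v, cmod_set z v -> v ≼ u) -> s n ≼ u.
  by move=> hu; apply: (hs n).2 => _ /= /mapP[c _ ->]; apply: hu; exists (node n c).
have ss m n : s m ≼ s n + n.+1%:R^-1 *: e by apply: lb => v; exact: ub.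
have e0 : 0 ≼ e by apply: ble_add0; exact: babs_ge0.
have sc (n : nat) : 0 ≼ n.+1%:R^-1 *: e by apply: bl_scale => //; rewrite invr_ge0.
have [t st] : exists t, forall d : R, 0 < d -> exists N, forall n, (N <= n)%N -> `|s n - t| <= d.
  apply: cauchy_seq_lim => d d0; have d2 : 0 < d / 2 by lra.
  have [N hN] := le_div_nat (normr_ge0 e) d2.
  exists N => m n mN nN.
  apply: le_trans (_ : `|(m.+1%:R^-1 + n.+1%:R^-1) *: e| <= _).
    apply: (bnorm_abs_le (BL := BL)); rewrite scalerDl.
      apply: (@ble_trans _ _ _ (n.+1%:R^-1 *: e)); last by rewrite addrC; exact: ble_addl.
      by apply/ble_subl; rewrite addrC.
    rewrite opprB; apply: (@ble_trans _ _ _ (m.+1%:R^-1 *: e)); last exact: ble_addl.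
    by apply/ble_subl; rewrite addrC.
  rewrite normrZ ger0_norm; last by rewrite addr_ge0 ?invr_ge0.
  by rewrite mulrDl ![_^-1 * _]mulrC [leRHS]splitr; exact: lerD (hN m mN) (hN n nN).
exists t; split=> [v /(ub _) hv|u /lb hu].
  apply: (ble_lim (u := fun n => s n + n.+1%:R^-1 *: e)) => d d0.
  have d2 : 0 < d / 2 by lra.
  have [N hN] := st _ d2; have [N' hN'] := le_div_nat (normr_ge0 e) d2.
  exists (maxn N N'); split; first exact: hv.
  rewrite addrAC; apply: le_trans (ler_normD _ _) _.
  rewrite normrZ ger0_norm ?invr_ge0// [_^-1 * _]mulrC [leRHS]splitr lerD//.
    by apply: hN; rewrite leq_maxl.
  by apply: hN'; rewrite leq_maxr.
rewrite -(opprK t) -(opprK u); apply: ble_opp.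
apply: (ble_lim (u := fun n => - s n)) => d /st[N hN].
exists N; split; first exact/ble_opp.
by rewrite opprK addrC distrC hN.
Qed.

End Existence.

Lemma cmod_ge0 z : 0 ≼ cmod BL z.
Proof.
have [h _] := cmod_lub z; apply: ble_add_double_ge0; rewrite -(subrr z.1).
apply: ble_add2; apply: h; first by exists 0; rewrite cos0 sin0 scale1r scale0r addr0.
by exists pi; rewrite cospi sinpi scaleN1r scale0r addr0.
Qed.

(** The angles [0], [pi] and [pi / 2], [- (pi / 2)] place both signs of each component below the
    modulus. With [cnorm_le_norm], limits for [cnorm] become limits for the maximum norm. *)
Lemma norm_le_cnorm z : `|z| <= cnorm BL z.
Proof.
have [h _] := cmod_lub z; rewrite prod_normE ge_max; apply/andP; split.
  apply: (bnorm_abs_le (BL := BL)); apply: h.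
    by exists 0; rewrite cos0 sin0 scale1r scale0r addr0.
  by exists pi; rewrite cospi sinpi scaleN1r scale0r addr0.
apply: (bnorm_abs_le (BL := BL)); apply: h.
  by exists (pi / 2); rewrite cos_pihalf sin_pihalf scale1r scale0r add0r.
by exists (- (pi / 2)); rewrite cosN sinN cos_pihalf sin_pihalf scaleN1r scale0r add0r.
Qed.

Lemma cnorm_le_norm z : cnorm BL z <= 2 * `|z|.
Proof.
have [_ h] := cmod_lub z.
have le (c : R) x : `|c| <= 1 -> c *: x ≼ babs BL x.
  move=> c1; apply: ble_trans (scale_le_babs _ _) _; apply/ble_sub0.
  rewrite -{1}[babs BL x]scale1r -scalerBl.
  by apply: bl_scale; [rewrite subr_ge0|exact: babs_ge0].
have : cmod BL z ≼ babs BL z.1 + babs BL z.2.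
  apply: h => _ [th ->]; apply: ble_add2; apply: le.
    by rewrite ler_norml cos_geN1 cos_le1.
  by rewrite ler_norml sin_geN1 sin_le1.
move/(bnorm_le (cmod_ge0 z)) => /le_trans; apply.
apply: le_trans (ler_normD _ _) _; rewrite !bnorm_babs mulrDl mul1r.
by rewrite lerD// prod_normE le_max lexx ?orbT.
Qed.

Lemma cnorm_real x : cnorm BL (x, 0) = `|x|.
Proof.
apply/eqP; rewrite eq_le; apply/andP; split; last first.
  by apply: le_trans (norm_le_cnorm (x, 0)); rewrite prod_normE le_max lexx.
have [_ h] := cmod_lub (x, 0).
rewrite -(bnorm_babs BL x); apply: bnorm_le; first exact: cmod_ge0.
apply: h => _ [th ->] /=; rewrite scaler0 addr0.
apply: ble_trans (scale_le_babs _ _) _; apply/ble_sub0.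
rewrite -{1}[babs BL x]scale1r -scalerBl.
apply: bl_scale; last exact: babs_ge0.
by rewrite subr_ge0 ler_norml cos_geN1 cos_le1.
Qed.

End ComplexModulus.

(** * Riemann sums and Cesaro means of a bounded semigroup *)

Section BoundedSemigroup.
Variables (R : realType) (W : normedModType R) (T : R -> W -> W) (K : R).

Hypothesis W_complete : forall u : nat -> W,
  (forall e : R, 0 < e -> exists N, forall m n, (N <= m)%N -> (N <= n)%N ->
    `|u m - u n| <= e) ->
  exists l, forall e : R, 0 < e -> exists N, forall n, (N <= n)%N -> `|u n - l| <= e.
Hypothesis T_add : forall (t : R) z w, 0 <= t -> T t (z + w) = T t z + T t w.
Hypothesis T_scale : forall (t r : R) z, 0 <= t -> T t (r *: z) = r *: T t z.
Hypothesis T_comp : forall (t s : R) z, 0 <= t -> 0 <= s -> T (t + s) z = T t (T s z).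
Hypothesis K_gt0 : 0 < K.
Hypothesis T_bounded : forall (t : R) z, 0 <= t -> `|T t z| <= K * `|z|.
Hypothesis T_continuous : forall z (e : R), 0 < e -> exists2 d : R, 0 < d &
  forall t : R, 0 <= t -> t < d -> `|T t z - z| <= e.

Definition sample z (t : R) (n k : nat) : W := T (k%:R * t / n%:R) z.

Definition sample_mean z t n : W := n%:R^-1 *: \sum_(0 <= k < n) sample z t n k.

Definition riemann_integral z t I := forall e : R, 0 < e -> exists N, forall n,
  (N <= n)%N -> `|t *: sample_mean z t n - I| <= e.

Lemma T_sub t z w : 0 <= t -> T t (z - w) = T t z - T t w.
Proof. by move=> t0; apply/eqP; rewrite eq_sym subr_eq -T_add// subrK. Qed.

Lemma T_sum t (F : nat -> W) n : 0 <= t ->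
  T t (\sum_(0 <= k < n) F k) = \sum_(0 <= k < n) T t (F k).
Proof.
move=> t0; elim: n => [|n IH]; last by rewrite !big_nat_recr//= T_add// IH.
by rewrite !big_geq// -{1}(scale0r (0 : W)) T_scale// scale0r.
Qed.

Lemma time_ge0 t n k : 0 <= t -> 0 <= k%:R * t / n%:R :> R.
Proof. by move=> t0; rewrite !mulr_ge0// invr_ge0. Qed.

Lemma sample_bound z t n k : 0 <= t -> `|sample z t n k| <= K * `|z|.
Proof. by move=> t0; exact/T_bounded/time_ge0. Qed.

Lemma norm_sum_le (F : nat -> W) (c : R) n : (forall k, (k < n)%N -> `|F k| <= c) ->
  `|\sum_(0 <= k < n) F k| <= n%:R * c.
Proof.
elim: n => [|n IH] h; first by rewrite big_geq// normr0 mul0r.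
rewrite big_nat_recr//= -addn1 natrD mulrDl mul1r.
apply: le_trans (ler_normD _ _) _; apply: lerD; last exact: h.
by apply: IH => k kn; apply: h; exact: leqW.
Qed.

Lemma sum_cat (F : nat -> W) a b :
  \sum_(0 <= i < a + b) F i = \sum_(0 <= i < a) F i + \sum_(0 <= i < b) F (a + i)%N.
Proof.
rewrite (big_cat_nat (n := a))//= ?leq_addr//; congr (_ + _).
rewrite -{1}[a]add0n big_addn addKn.
by apply: eq_bigr => j _; rewrite addnC.
Qed.

Lemma sum_shift_sub (F : nat -> W) n k :
  \sum_(0 <= i < n) F (i + k)%N - \sum_(0 <= i < n) F i =
  \sum_(0 <= i < k) (F (n + i)%N - F i).
Proof.
under eq_bigr do rewrite addnC.
have e : \sum_(0 <= i < k) F i + \sum_(0 <= i < n) F (k + i)%N =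
    \sum_(0 <= i < n) F i + \sum_(0 <= i < k) F (n + i)%N.
  by rewrite -!sum_cat addnC.
rewrite sumrB; apply/eqP; rewrite subr_eq addrAC eq_sym subr_eq eq_sym.
by rewrite [X in X == _]addrC e addrC.
Qed.

Lemma sum_blocks (F : nat -> W) n m :
  \sum_(0 <= i < n * m) F i = \sum_(0 <= k < n) \sum_(0 <= j < m) F (k * m + j)%N.
Proof.
elim: n => [|n IH]; first by rewrite mul0n !big_geq.
by rewrite big_nat_recr//= -IH mulSn addnC sum_cat.
Qed.

(** Each coarse sample is compared with the [m] fine samples of its interval. The semigroup law
    factors out the operator at the left endpoint, at the cost of [K]. *)
Lemma sample_mean_refine z t n m e : 0 <= t -> (0 < n)%N -> (0 < m)%N -> 0 <= e ->
  (forall h, 0 <= h -> h <= t / n%:R -> `|T h z - z| <= e) ->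
  `|sample_mean z t n - sample_mean z t (n * m)| <= K * e.
Proof.
move=> t0 n0 m0 e0 h.
have nR : 0 < n%:R :> R by rewrite ltr0n.
have mR : 0 < m%:R :> R by rewrite ltr0n.
have -> : sample_mean z t n - sample_mean z t (n * m) = (n * m)%:R^-1 *:
    \sum_(0 <= k < n) \sum_(0 <= j < m) (sample z t n k - sample z t (n * m) (k * m + j)).
  under eq_bigr do rewrite sumrB.
  rewrite sumrB -sum_blocks scalerBr; congr (_ - _).
  under [in RHS]eq_bigr do rewrite sumr_const_nat subn0 -scaler_nat.
  rewrite -scaler_sumr scalerA natrM invfM -mulrA mulVf ?mulr1//.
  by rewrite gt_eqF.
rewrite normrZ gtr0_norm; last by rewrite invr_gt0 ltr0n muln_gt0 n0.
rewrite ler_pdivrMl; last by rewrite ltr0n muln_gt0 n0.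
rewrite natrM -mulrA; apply: norm_sum_le => k kn; apply: norm_sum_le => j jm.
have -> : sample z t (n * m) (k * m + j) = T (k%:R * t / n%:R) (T (j%:R * t / (n * m)%:R) z).
  rewrite -T_comp ?time_ge0// /sample; congr (T _ z).
  rewrite natrD !natrM; field.
  by rewrite !gt_eqF.
rewrite /sample -T_sub ?time_ge0//; apply: le_trans (T_bounded _ (time_ge0 _ _ t0)) _.
rewrite ler_wpM2l ?(ltW K_gt0)// distrC; apply: h; first exact: time_ge0.
have -> : j%:R * t / (n * m)%:R = t / n%:R * (j%:R / m%:R) :> R.
  by rewrite natrM; field; rewrite !gt_eqF.
rewrite ler_piMr ?divr_ge0// ler_pdivrMr// mul1r ler_nat; exact: ltnW.
Qed.

(** Partitions into [m] and [n] intervals are compared through their common refinement into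
    [m * n]. *)
Lemma riemann_integral_exists z t : 0 < t -> exists I, riemann_integral z t I.
Proof.
move=> t0; apply: W_complete => e e0.
have e1 : 0 < e / (2 * t * K) by rewrite divr_gt0// !mulr_gt0.
have [d d0 hd] := T_continuous z e1.
have d2 : 0 < d / 2 by lra.
have [N hN] := le_div_nat (ltW t0) d2.
have key n m : (N.+1 <= n)%N -> (0 < m)%N ->
    `|t *: sample_mean z t n - t *: sample_mean z t (n * m)| <= e / 2.
  case: n => // n nN m0; rewrite -scalerBr normrZ gtr0_norm// -ler_pdivlMl//.
  apply: le_trans (sample_mean_refine (ltW t0) _ m0 (ltW e1) _) _ => //.
    move=> h h0 hn; apply: hd => //; apply: le_lt_trans (le_trans hn (hN n nN)) _; lra.
  have -> // : K * (e / (2 * t * K)) = t^-1 * (e / 2).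
  by field; rewrite !gt_eqF.
exists N.+1 => m n mN nN.
have m0 : (0 < m)%N by apply: leq_trans mN.
have n0 : (0 < n)%N by apply: leq_trans nN.
have h1 := key m n mN n0; have h2 := key n m nN m0; rewrite mulnC in h2.
apply: le_trans (ler_distD (t *: sample_mean z t (m * n)) _ _) _.
by rewrite [leRHS]splitr lerD// distrC.
Qed.

Lemma scaled_dist (t e : R) (a b : W) : 0 < t -> `|t *: a - b| <= t * e -> `|a - t^-1 *: b| <= e.
Proof.
move=> t0; have -> : a - t^-1 *: b = t^-1 *: (t *: a - b).
  by rewrite scalerBr scalerA mulVf ?scale1r// gt_eqF.
by rewrite normrZ gtr0_norm ?invr_gt0// ler_pdivrMl.
Qed.

Lemma sum_indicator_le (c : R) n : 0 <= c ->
  \sum_(0 <= k < n) ((k%:R < c)%R)%:R <= c + 1.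
Proof.
(* The bound by [n%:R] is carried along because it controls the step in which the index [n] is still
   below [c]. *)
move=> c0; set s := (X in X <= _); suff : s <= n%:R /\ s <= c + 1 by case.
rewrite {}/s.
elim: n => [|n [h1 h2]]; first by rewrite big_geq//; split; lra.
rewrite big_nat_recr//= -addn1 natrD.
by case: ltP => /= nc; split; lra.
Qed.

(** Samples after time [q] are close to [L]; the earlier ones are a share of about [q / t] and
    differ from [L] by at most [B]. The four quarters of [e] pay for the integral, the late samples,
    the early share and the rounding of its count. *)
Lemma cesaro_of_limit z L :
  (forall e : R, 0 < e -> exists q, forall t, q <= t -> `|T t z - L| <= e) ->
  forall e : R, 0 < e -> exists2 t0 : R, 0 < t0 & forall t, t0 <= t -> forall I,
    riemann_integral z t I -> `|t^-1 *: I - L| <= e.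
Proof.
move=> h e e0; have e4 : 0 < e / 4 by lra.
have [q0 hq0] := h _ e4; pose q := Num.max q0 0.
have q_ge0 : 0 <= q by rewrite le_max lexx orbT.
have hq t : q <= t -> `|T t z - L| <= e / 4.
  by move=> qt; apply: hq0; apply: le_trans qt; rewrite le_max lexx.
pose B := K * `|z| + `|L|.
have B0 : 0 <= B by rewrite addr_ge0// mulr_ge0// ltW.
(* The first term makes [B * q / t] at most [e / 4]; the added 1 keeps [t] positive. *)
exists (4 * B * q / e + 1); first by rewrite ltr_pwDr// divr_ge0 ?(ltW e0)// !mulr_ge0.
move=> t tt0 I hI.
have t0 : 0 < t.
  by apply: lt_le_trans tt0; rewrite ltr_pwDr// divr_ge0 ?(ltW e0)// !mulr_ge0.
have te : 0 < t * (e / 4) by rewrite mulr_gt0.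
have [N1 hN1] := hI _ te; have [N2 hN2] := le_div_nat B0 e4.
pose n := (maxn N1 N2).+1.
have nR : 0 < n%:R :> R by [].
have h1 : `|sample_mean z t n - t^-1 *: I| <= e / 4.
  have := hN1 n (leqW (leq_maxl _ _)).
  exact: scaled_dist.
have h2 : B / n%:R <= e / 4 by apply: hN2; rewrite leq_maxr.
have h3 : B * q / t <= e / 4.
  rewrite ler_pdivrMr//; move: tt0; rewrite -lerBrDr ler_pdivrMr//; nra.
have h4 : `|sample_mean z t n - L| <= e / 4 + B * (q / t + n%:R^-1).
  have -> : sample_mean z t n - L = n%:R^-1 *: \sum_(0 <= k < n) (sample z t n k - L).
    by rewrite sumrB scalerBr sumr_const_nat subn0 -(scaler_nat _ L) scalerA mulVf ?scale1r ?gt_eqF.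
  rewrite normrZ gtr0_norm ?invr_gt0// ler_pdivrMl//.
  apply: le_trans (ler_norm_sum _ _ _) _.
  apply: (@le_trans _ _ (\sum_(0 <= k < n) (e / 4 + B * ((k%:R < n%:R * q / t)%R)%:R))).
    apply: ler_sum => k _; case: ltP => hk /=.
      rewrite mulr1; apply: le_trans (ler_normB _ _) _.
      by have := sample_bound z n k (ltW t0); rewrite /B; lra.
    rewrite mulr0 addr0; apply: hq.
    by rewrite ler_pdivlMr// mulrC; move: hk; rewrite ler_pdivrMr.
  rewrite big_split /= sumr_const_nat subn0 -mulr_sumr -(mulr_natl (e / 4)) mulrDr lerD//.
  have c0 : 0 <= n%:R * q / t by rewrite divr_ge0 ?(ltW t0)// mulr_ge0.
  have := ler_wpM2l B0 (sum_indicator_le n c0).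
  by move/le_trans; apply; rewrite le_eqVlt; apply/orP; left; apply/eqP; field; rewrite !gt_eqF.
apply: le_trans (ler_distD (sample_mean z t n) _ _) _; rewrite distrC.
lra.
Qed.

(** * From Cesaro convergence to convergence *)

Section MeanErgodic.
Variables (z L : W).
Hypothesis mean_lim : forall e : R, 0 < e -> exists2 t0 : R, 0 < t0 & forall t, t0 <= t ->
  forall I, riemann_integral z t I -> `|t^-1 *: I - L| <= e.

(** The hypothesis speaks of every [I] that is an integral, so it yields information only once such
    an [I] is known to exist. *)
Lemma sample_mean_lim (e : R) : 0 < e -> exists2 t0 : R, 0 < t0 & forall t, t0 <= t ->
  exists N, forall n, (N <= n)%N -> `|sample_mean z t n - L| <= e.
Proof.
move=> e0; have e2 : 0 < e / 2 by lra.
have [t0 t00 ht0] := mean_lim e2; exists t0 => // t tt0.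
have tp : 0 < t by apply: lt_le_trans tt0.
have [I hI] := riemann_integral_exists z tp.
have te : 0 < t * (e / 2) by rewrite mulr_gt0.
have [N hN] := hI _ te; exists N => n nN.
apply: le_trans (ler_distD (t^-1 *: I) _ _) _; rewrite [leRHS]splitr.
apply: lerD; last exact: ht0.
by apply: scaled_dist => //; exact: hN.
Qed.

(** Applying [T s] to a long sample mean [A] only changes boundary terms, so [T s A] is close to
    [A]. The factor [K + 2] adds this error, the distance of [A] from [L], and its image under
    [T s]. *)
Lemma mean_fixed s : 0 < s -> T s L = L.
Proof.
move=> s0; apply/eqP; rewrite -subr_eq0 -normr_le0; apply/ler_addgt0Pr => e e0; rewrite add0r.
have K2 : 0 < K + 2 by have := K_gt0; lra.
have d0 : 0 < e / (K + 2) by rewrite divr_gt0.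
set d := e / (K + 2) in d0.
have [t0 t00 ht0] := sample_mean_lim d0.
have C0 : 0 <= 2 * (K * `|z|) by rewrite !mulr_ge0// ltW.
have [N1 hN1] := le_div_nat C0 d0.
(* A large [m] makes the horizon [m%:R * s] exceed [t0] and the boundary terms, a share of order
   [1 / m], small. *)
pose m := (maxn N1 (Num.truncn (t0 / s))).+1.
have mR : 0 < m%:R :> R by [].
have tm : t0 <= m%:R * s.
  rewrite -ler_pdivrMr//; apply/ltW/(lt_le_trans (truncnS_gt _)).
  by rewrite ler_nat ltnS leq_maxr.
have [N hN] := ht0 _ tm.
(* With this [n] the time [s] is exactly [N.+1] mesh widths, so [T s] moves samples to samples. *)
pose n := (m * N.+1)%N; pose t := m%:R * s.
have t_ge0 : 0 <= t by rewrite mulr_ge0// ltW.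
have nN : (N <= n)%N by rewrite /n mulnS; apply: leq_trans (leq_addl _ _); rewrite leq_pmull.
have nR : 0 < n%:R :> R by rewrite ltr0n muln_gt0.
set A := sample_mean z t n; have AL : `|A - L| <= d by exact: hN.
have shift_le : `|T s A - A| <= d.
  rewrite /A /sample_mean T_scale ?(ltW s0)// T_sum ?(ltW s0)// -scalerBr.
  have -> : \sum_(0 <= k < n) T s (sample z t n k) = \sum_(0 <= k < n) sample z t n (k + N.+1)%N.
    apply: eq_bigr => k _; rewrite /sample -T_comp ?(ltW s0) ?time_ge0//; congr (T _ z).
    by rewrite natrD /t /n natrM; field; rewrite !gt_eqF.
  rewrite sum_shift_sub normrZ gtr0_norm ?invr_gt0// ler_pdivrMl//.
  apply: le_trans (norm_sum_le (c := 2 * (K * `|z|)) _) _.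
    move=> k _; apply: le_trans (ler_normB _ _) _.
    by have := sample_bound z n (n + k) t_ge0; have := sample_bound z n k t_ge0; lra.
  rewrite /n natrM [m%:R * _]mulrC -mulrA ler_wpM2l// [m%:R * d]mulrC.
  by rewrite -ler_pdivrMr//; apply: hN1; rewrite leq_maxl.
have -> : T s L - L = (T s A - A) - T s (A - L) + (A - L).
  by rewrite T_sub ?(ltW s0)// opprB [T s A - A + _]addrC !subrKA.
have := T_bounded (A - L) (ltW s0).
have : K * `|A - L| <= K * d by rewrite ler_wpM2l// ltW.
have -> : e = (K + 2) * d by rewrite /d mulrC divfK// gt_eqF.
move=> h1 h2; apply: le_trans (ler_normD _ _) _.
by have := ler_normB (T s A - A) (T s (A - L)); lra.
Qed.

Hypothesis asymp : forall s (e : R), 0 <= s -> 0 < e -> exists q, forall t, q <= t ->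
  `|T (t + s) z - T t z| <= e.

(** Fix one sample mean [A] near [L]. For late [t], each of its finitely many samples has nearly the
    same image as [z], so [T t A] is near [T t z]; it is also near [L], because [L] is fixed. *)
Lemma limit_of_cesaro (e : R) : 0 < e -> exists q, forall t, q <= t -> `|T t z - L| <= e.
Proof.
move=> e0; have K1 : 0 < K + 1 by have := K_gt0; lra.
have d0 : 0 < e / (K + 1) by rewrite divr_gt0.
set d := e / (K + 1) in d0.
have [t0 t00 ht0] := sample_mean_lim d0.
have [N hN] := ht0 _ (lexx t0).
set n := N.+1; have nR : 0 < n%:R :> R by [].
set A := sample_mean z t0 n; have AL : `|A - L| <= d by exact/hN/leqnSn.
have [q hq] : exists q, forall t, q <= t -> forall k, (k < n)%N ->
    `|T (t + k%:R * t0 / n%:R) z - T t z| <= d.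
  elim: {1}n => [|m [q hq]]; first by exists 0.
  have [q' hq'] := asymp (time_ge0 n m (ltW t00)) d0.
  exists (Num.max q q') => t; rewrite ge_max => /andP[qt q't] k.
  by rewrite ltnS leq_eqVlt => /predU1P[->|]; [exact: hq'|exact: hq].
exists (Num.max q 1) => t; rewrite ge_max => /andP[qt t1].
have tp : 0 < t by lra.
have tge := ltW tp.
have h1 : `|T t A - T t z| <= d.
  have -> : T t A - T t z = n%:R^-1 *: \sum_(0 <= k < n) (T t (sample z t0 n k) - T t z).
    rewrite sumrB scalerBr sumr_const_nat subn0 -(scaler_nat _ (T t z))
      scalerA mulVf ?scale1r ?gt_eqF//.
    by rewrite /A /sample_mean T_scale// T_sum.
  rewrite normrZ gtr0_norm ?invr_gt0// ler_pdivrMl//; apply: norm_sum_le => k kn.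
  by rewrite /sample -T_comp ?time_ge0 ?(ltW t00)//; exact: hq.
have h2 : `|T t A - L| <= K * d.
  rewrite -{1}(mean_fixed tp) -T_sub//; apply: le_trans (T_bounded _ tge) _.
  by rewrite ler_wpM2l// ltW.
have -> : e = (K + 1) * d by rewrite /d mulrC divfK// gt_eqF.
apply: le_trans (ler_distD (T t A) _ _) _; rewrite distrC; lra.
Qed.

End MeanErgodic.
End BoundedSemigroup.

(** * The equivalence *)

Lemma cnorm_csub_ge (R : realType) (V : completeNormedModType R) (BL : BanachLattice V)
  (z w : V * V) : `|z - w| <= cnorm BL (csub z w).
Proof. exact: (norm_le_cnorm BL (z - w)). Qed.

Lemma cnorm_csub_le (R : realType) (V : completeNormedModType R) (BL : BanachLattice V)
  (z w : V * V) : cnorm BL (csub z w) <= 2 * `|z - w|.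
Proof. exact: (cnorm_le_norm BL (z - w)). Qed.

Lemma pair_complete (R : realType) (V : completeNormedModType R) (u : nat -> V * V) :
  (forall e : R, 0 < e -> exists N, forall m n, (N <= m)%N -> (N <= n)%N ->
    `|u m - u n| <= e) ->
  exists l, forall e : R, 0 < e -> exists N, forall n, (N <= n)%N -> `|u n - l| <= e.
Proof.
move=> h.
have [l1 h1] : exists l, forall e : R, 0 < e -> exists N, forall n, (N <= n)%N ->
    `|(u n).1 - l| <= e.
  apply: cauchy_seq_lim => e /h[N hN]; exists N => m n mN nN.
  by apply: le_trans (hN m n mN nN); rewrite [leRHS]prod_normE le_max lexx.
have [l2 h2] : exists l, forall e : R, 0 < e -> exists N, forall n, (N <= n)%N ->
    `|(u n).2 - l| <= e.
  apply: cauchy_seq_lim => e /h[N hN]; exists N => m n mN nN.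
  by apply: le_trans (hN m n mN nN); rewrite [leRHS]prod_normE le_max lexx orbT.
exists (l1, l2) => e e0; have [N1 hN1] := h1 e e0; have [N2 hN2] := h2 e e0.
exists (maxn N1 N2) => n; rewrite geq_max => /andP[n1 n2].
by rewrite prod_normE ge_max hN1//= hN2.
Qed.

Section MainResult.
Variables (R : realType) (V : completeNormedModType R) (BL : BanachLattice V).
Variable T : R -> V * V -> V * V.
Hypotheses (C0 : C0_semigroup BL T) (pos : unif_eventually_positive BL T).
Hypotheses (bd : sg_bounded BL T) (nc : norm_continuous_at_infinity BL T).

Local Notation "x ≼ y" := (bl_le BL x y) (at level 70).

Lemma sg_add (t : R) z w : 0 <= t -> T t (z + w) = T t z + T t w.
Proof. by move=> t0; have [h _] := (C0.1 t t0).1; exact: h. Qed.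

Lemma sg_cscale (t a b : R) z : 0 <= t -> T t (Defs.cscale a b z) = Defs.cscale a b (T t z).
Proof. by move=> t0; have [_ h] := (C0.1 t t0).1; exact: h. Qed.

Lemma cscale_real (a : R) (z : V * V) : Defs.cscale a 0 z = a *: z.
Proof. by rewrite /Defs.cscale !scale0r subr0 addr0. Qed.

Lemma sg_scale (t r : R) z : 0 <= t -> T t (r *: z) = r *: T t z.
Proof. by move=> t0; rewrite -!cscale_real sg_cscale. Qed.

Lemma sg_sub (t : R) z w : 0 <= t -> T t (z - w) = T t z - T t w.
Proof. by move=> t0; apply/eqP; rewrite eq_sym subr_eq -sg_add// subrK. Qed.

Lemma sg_comp (t s : R) z : 0 <= t -> 0 <= s -> T (t + s) z = T t (T s z).
Proof. by move=> t0 s0; case: C0 => _ [_ [h _]]; exact: h. Qed.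

Lemma sg_norm_bounded : exists2 K : R, 0 < K & forall t z, 0 <= t -> `|T t z| <= K * `|z|.
Proof.
have [M hM] := bd; exists (`|M| * 2 + 1); first by rewrite ltr_pwDr// mulr_ge0.
move=> t z t0; apply: le_trans (norm_le_cnorm BL _) _; apply: le_trans (hM t z t0) _.
rewrite mulrDl mul1r -mulrA ler_wpDr//.
apply: le_trans (_ : `|M| * cnorm BL z <= _); first by rewrite ler_wpM2r ?ler_norm// /cnorm.
by rewrite ler_wpM2l//; exact: cnorm_le_norm.
Qed.

Lemma sg_continuous z (e : R) : 0 < e -> exists2 d : R, 0 < d &
  forall t : R, 0 <= t -> t < d -> `|T t z - z| <= e.
Proof.
move=> e0; case: C0 => _ [_ [_ /(_ z e e0)[d [d0 hd]]]]; exists d => // t t0 td.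
exact: le_trans (cnorm_csub_ge BL _ _) (hd t t0 td).
Qed.

Lemma cconverges_toP g L : cconverges_to BL g L <->
  (forall e : R, 0 < e -> exists q, forall t, q <= t -> `|g t - L| <= e).
Proof.
split=> h e e0.
  have [q hq] := h e e0; exists q => t /hq; exact: le_trans (cnorm_csub_ge BL _ _).
have e2 : 0 < e / 2 by lra.
have [q hq] := h _ e2; exists q => t /hq; move: (cnorm_csub_le BL (g t) L); lra.
Qed.

Lemma is_cintP z t I : is_cint BL (T^~ z) t I <-> riemann_integral T z t I.
Proof.
have E n : rsum (T^~ z) t n = t *: sample_mean T z t n.
  rewrite /sample_mean scalerA /sample big_mkord /rsum.
  rewrite [X in _ = _ *: X]surjective_pairing.
  by rewrite !(big_morph fst (fun _ _ => erefl) erefl) !(big_morph snd (fun _ _ => erefl) erefl).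
split=> h e e0.
  by have [N hN] := h e e0; exists N => n /hN; rewrite -E; exact: le_trans (cnorm_csub_ge BL _ _).
have e2 : 0 < e / 2 by lra.
have [N hN] := h _ e2; exists N => n /hN; rewrite -E.
by move: (cnorm_csub_le BL (rsum (T^~ z) t n) I); lra.
Qed.

Lemma mean_ergodicP : mean_ergodic BL T <-> forall z, exists L, forall e : R, 0 < e ->
  exists2 t0 : R, 0 < t0 & forall t, t0 <= t -> forall I,
    riemann_integral T z t I -> `|t^-1 *: I - L| <= e.
Proof.
split=> h z; have [L hL] := h z; exists L => e e0.
  have [t0 [t00 ht0]] := hL e e0; exists t0 => // t /ht0 H I /is_cintP/H.
  exact: le_trans (cnorm_csub_ge BL _ _).
have e2 : 0 < e / 2 by lra.
have [t0 t00 ht0] := hL _ e2; exists t0; split=> // t /ht0 H I /is_cintP/H.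
by move: (cnorm_csub_le BL (t^-1 *: I) L); rewrite /rscale; lra.
Qed.

Section ZeroGrowth.
Hypothesis growth0 : fine (growth_bound BL T) = 0.

Let S (t : R) (x : V) : V := (T t (x, 0)).1.

(** Positivity makes the images of [bpos x] and [bpos (- x)] real, hence also that of their
    difference [x]. *)
Lemma sg_real t0 s x : 0 <= s -> t0 <= s -> (forall t, t0 <= t -> cpositive BL (T t)) ->
  T s (x, 0) = (S s x, 0).
Proof.
move=> s0 ts tp; rewrite [LHS]surjective_pairing; congr (_, _).
have -> : (x, 0) = (bpos BL x, 0) - (bpos BL (- x), 0) :> V * V.
  by rewrite {1}(bpos_decomp BL x); congr (_, _); rewrite /= subr0.
rewrite sg_sub//= (tp s ts _ (bpos_ge0 BL x)).1 (tp s ts _ (bpos_ge0 BL (- x))).1.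
by rewrite subr0.
Qed.

Lemma sg_asymptotic z (s e : R) : 0 <= s -> 0 < e -> exists q, forall t, q <= t ->
  `|T (t + s) z - T t z| <= e.
Proof.
move=> s0 e0; have [t0 [t00 tp]] := pos; have [M hM] := bd.
have real q x : t0 <= q -> T q (x, 0) = (S q x, 0).
  by move=> tq; apply: (sg_real (t0 := t0)) => //; lra.
have S_add q x y : t0 <= q -> S q (x + y) = S q x + S q y.
  move=> tq; rewrite /S; have -> : (x + y, 0) = (x, 0) + (y, 0) :> V * V.
    by congr (_, _); rewrite /= addr0.
  by rewrite sg_add//; lra.
have S_pos q x : t0 <= q -> 0 ≼ x -> 0 ≼ S q x by move=> tq /(tp q tq)[].
have S_comp q q' x : t0 <= q -> t0 <= q' -> S (q + q') x = S q (S q' x).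
  by move=> tq tq'; rewrite {1}/S sg_comp ?real//; lra.
have S_bd q x : t0 <= q -> `|S q x| <= (`|M| + 1) * `|x|.
  move=> tq; have q0 : 0 <= q by lra.
  rewrite -[X in X <= _](cnorm_real BL) -real//; apply: le_trans (hM _ _ q0) _.
  by rewrite cnorm_real ler_wpM2r//; have := ler_norm M; lra.
have S_cont (d : R) : 0 < d -> exists r c : R, [/\ t0 <= r, 0 < c &
    forall h x, `|h| < c -> t0 <= r + h /\ `|S (r + h) x - S r x| <= d * `|x|].
  move=> d0; have [_ /= H] := nc; rewrite growth0 in H.
  have [T1 hT1] := H d d0.
  (* The extra 1, with [h] restricted to absolute value below 1, keeps [r + h] beyond [t0]. *)
  pose r := Num.max T1 (t0 + 1).
  have rT : T1 <= r by rewrite le_max lexx.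
  have rt : t0 + 1 <= r by rewrite le_max lexx orbT.
  have [c [c0 hc]] := hT1 r rT.
  exists r, (Num.min c 1); split; [lra|by rewrite lt_min c0 ltr01|].
  move=> h x; rewrite lt_min => /andP[hc1]; rewrite ltr_norml => /andP[h1 h2].
  split; first by lra.
  have rh0 : 0 <= r + h by lra.
  have := hc h hc1 rh0 (x, 0).
  rewrite /rscale oppr0 !mul0r expR0 !real ?cnorm_real; [|lra..].
  apply: le_trans; rewrite distrC.
  apply: le_trans (norm_le_cnorm BL _); rewrite prod_normE le_max /= !scale1r.
  by rewrite lexx.
have M0 : 0 < `|M| + 1 by rewrite ltr_pwDr.
have asy x := asymptotically_constant t00 S_add S_pos S_comp S_bd M0 S_cont x s 0 e0.
have [q1 h1] := asy z.1; have [q2 h2] := asy z.2.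
have full q : t0 <= q -> T q z = (S q z.1, S q z.2).
  move=> tq; have q0 : 0 <= q by lra.
  have -> : z = (z.1, 0) + Defs.cscale 0 1 (z.2, 0).
    rewrite /Defs.cscale /= !scale0r !scale1r subr0.
    by rewrite [LHS]surjective_pairing; congr (_, _); rewrite /= ?addr0 ?add0r.
  rewrite sg_add// sg_cscale// !real//= /Defs.cscale /= !scale0r !scale1r subr0.
  by congr (_, _); rewrite /= ?addr0 ?add0r.
exists (Num.max t0 (Num.max q1 q2)) => t; rewrite prod_normE !ge_max => /and3P[tt tq1 tq2].
rewrite !full//; last by lra.
apply/andP; split.
  by have := h1 t tq1; rewrite addr0.
by have := h2 t tq2; rewrite addr0.
Qed.

End ZeroGrowth.

Lemma growth_bound_le0 : (growth_bound BL T <= 0)%E.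
Proof.
apply: ereal_inf_lbound; exists 0 => //; have [M hM] := bd; exists M => t z t0.
by rewrite mul0r expR0 mulr1; exact: hM.
Qed.

Lemma negative_growth_limit z : (growth_bound BL T < 0)%E ->
  cconverges_to BL (fun t => T t z) 0.
Proof.
move=> /ereal_inf_lt[_ [w [M hM] <-]]; rewrite lte_fin => w0 e e0.
have c0 : 0 <= `|M| * cnorm BL z by rewrite mulr_ge0// /cnorm.
set c := `|M| * cnorm BL z in c0.
(* Beyond this time [c / e] is at most [- (w * t)], hence at most [expR (- (w * t))]. *)
exists (c / e / - w) => t tc.
have wN : 0 < - w by lra.
have t0 : 0 <= t by apply: le_trans tc; rewrite !divr_ge0// ltW.
have -> : csub (T t z) 0 = T t z by rewrite /csub /= !subr0 -surjective_pairing.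
apply: le_trans (hM t z t0) _; rewrite mulrAC.
have ex : expR (w * t) * (c / e) <= 1.
  have h : c / e <= expR (- (w * t)).
    apply: le_trans (_ : 1 + - (w * t) <= _); last exact: expR_ge1Dx.
    by move: tc; rewrite ler_pdivrMr//; lra.
  have := ler_wpM2l (expR_ge0 (w * t)) h; rewrite -expRD subrr expR0; exact.
apply: (@le_trans _ _ (c * expR (w * t))).
  rewrite ler_wpM2r ?expR_ge0// /c ler_wpM2r ?ler_norm// /cnorm//.
by move: ex; rewrite mulrA ler_pdivrMr// mul1r mulrC.
Qed.

Lemma limit_iff_mean_ergodic :
  (forall z, exists L, cconverges_to BL (fun t => T t z) L) <-> mean_ergodic BL T.
Proof.
have [K K0 TK] := sg_norm_bounded.
split=> [h|].
  apply/mean_ergodicP => z; have [L /cconverges_toP hL] := h z.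
  by exists L; exact: (cesaro_of_limit K0 TK hL).
move=> /mean_ergodicP h z.
have := growth_bound_le0; rewrite le_eqVlt => /predU1P[g0|g0]; last first.
  by exists 0; exact: negative_growth_limit.
have f0 : fine (growth_bound BL T) = 0 by rewrite g0.
have [L hL] := h z; exists L; apply/cconverges_toP => e e0.
by apply: (limit_of_cesaro (@pair_complete R V) sg_add sg_scale sg_comp K0 TK
  sg_continuous hL) => // s d; exact: sg_asymptotic.
Qed.

End MainResult.

Unset Implicit Arguments.

Theorem theorem3p1 (R : realType) (V : completeNormedModType R)
  (BL : BanachLattice V) (T : R -> V * V -> V * V) :
  C0_semigroup BL T -> unif_eventually_positive BL T -> sg_bounded BL T ->
  norm_continuous_at_infinity BL T ->
  ((forall z, exists L, cconverges_to BL (fun t => T t z) L) <-> mean_ergodic BL T).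
Proof.
by move=> C0 pos bd nc; exact: limit_iff_mean_ergodic.
Qed.
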